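(* Let $\Omega(\mathbb{R}^m)$ be the space of Borel probability measures on $\mathbb{R}^m$ with the metric $d_L$. The sets $\Omega_0(\mathbb{R}^m)=\{\mu\in\Omega(\mathbb{R}^m):\lim_{r\to0^+}D_r(\mu)=D_0(\mu)=\dim_H(\mu)\}$ and $\Omega_{0>}(\mathbb{R}^m)=\{\mu\in\Omega(\mathbb{R}^m):\lim_{r\to0^+}D_r(\mu)=D_0(\mu)>\dim_H(\mu)\}$ are both dense in $(\Omega(\mathbb{R}^m),d_L)$.
   Context: $d_L(\mu,\nu)=\sup\{|\int h\,d\mu-\int h\,d\nu|: h:\mathbb{R}^m\to\mathbb{R}\text{ Lipschitz with constant}\le1\}$. For $r>0$, $V_{n,r}(\mu)=\inf\{\int d(x,A)^r\,d\mu(x):\mathrm{Card}(A)\le n\}$ and $D_r(\mu)=\lim_n\frac{r\log n}{-\log V_{n,r}(\mu)}$; $e_n(\mu)=\exp\inf\{\int\log d(x,A)\,d\mu(x):\mathrm{Card}(A)\le n\}$ and $D_0(\mu)=\lim_n\frac{\log n}{-\log e_n(\mu)}$; throughout it is assumed these quantization dimensions exist whenever they occur. $\dim_H(\mu)=\inf\{\dim_H E: E\text{ Borel},\ \mu(E)=1\}$ is the Hausdorff dimension of $\mu$.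
   Formalization: Ω(R^m) is restricted to Borel probability measures with finite first moment, since otherwise d_L is infinite or undefined (∞−∞ for h(x)=|x|), and m ≥ 1 is assumed, since for m = 0 the set Ω_{0>} is empty. *)

(* Defs.v *)
From HB Require Import structures.
From mathcomp Require Import all_boot all_order all_algebra.
From mathcomp Require Import all_classical all_reals all_analysis.
Set Implicit Arguments. Unset Strict Implicit. Unset Printing Implicit Defensive.
Import Order.TTheory GRing.Theory Num.Theory.
Import numFieldNormedType.Exports.
Local Open Scope classical_set_scope.
Local Open Scope ring_scope.

Definition Rm (R : realType) (m : nat) := g_sigma_algebraType (@open 'rV[R]_m).

Definition edist {R : realType} {m : nat} (x y : 'rV[R]_m) : R :=
  Num.sqrt (\sum_(i < m) (x ord0 i - y ord0 i) ^+ 2).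

Definition lip1 {R : realType} {m : nat} (h : 'rV[R]_m -> R) : Prop :=
  forall x y, `|h x - h y| <= edist x y.

(* Omega(R^m): Borel probability measures with finite first moment
   (the domain on which d_L is a (finite) metric). *)
Definition in_Omega {R : realType} {m : nat} (mu : probability (Rm R m) R) : Prop :=
  (\int[mu]_x (edist x 0)%:E < +oo)%E.

Definition dL {R : realType} {m : nat} (mu nu : probability (Rm R m) R) : \bar R :=
  ereal_sup [set `| (\int[mu]_x (h x)%:E - \int[nu]_x (h x)%:E)%E |%E
            | h in [set h : 'rV[R]_m -> R | lip1 h]].

(* d(x,A) for a nonempty finite set A given by a sequence *)
Definition dA {R : realType} {m : nat} (x : 'rV[R]_m) (A : seq 'rV[R]_m) : R :=
  \big[Num.min/edist x (head x A)]_(a <- A) edist x a.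

Definition elog {R : realType} (x : \bar R) : \bar R :=
  match x with
  | r%:E => if r == (0:R)%R then -oo else (ln r)%:E
  | +oo => +oo
  | -oo => -oo
  end%E.

Definition codebooks {R : realType} {m : nat} (n : nat) : set (seq 'rV[R]_m) :=
  [set A | (0 < size A <= n)%N].

Definition Vq {R : realType} {m : nat} (mu : probability (Rm R m) R) (n : nat) (r : R)
  : \bar R :=
  ereal_inf [set (\int[mu]_x ((dA x A) `^ r)%:E)%E | A in codebooks n].

Definition qratio {R : realType} {m : nat} (mu : probability (Rm R m) R) (r : R) (n : nat)
  : \bar R :=
  ((r * ln n%:R)%:E * (- elog (Vq mu n r))^-1)%E.

Definition has_Dr {R : realType} {m : nat} (mu : probability (Rm R m) R) (r D : R) : Prop :=
  qratio mu r n @[n --> \oo] --> D%:E.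

Definition logen {R : realType} {m : nat} (mu : probability (Rm R m) R) (n : nat) : \bar R :=
  ereal_inf [set (\int[mu]_x elog (dA x A)%:E)%E | A in codebooks n].

Definition qratio0 {R : realType} {m : nat} (mu : probability (Rm R m) R) (n : nat) : \bar R :=
  ((ln n%:R)%:E * (- logen mu n)^-1)%E.

Definition has_D0 {R : realType} {m : nat} (mu : probability (Rm R m) R) (D : R) : Prop :=
  qratio0 mu n @[n --> \oo] --> D%:E.

Definition rdiam {R : realType} {m : nat} (U : set 'rV[R]_m) : R :=
  sup [set edist p.1 p.2 | p in U `*` U].

Definition hterm {R : realType} {m : nat} (s : R) (U : set 'rV[R]_m) : R :=
  if `[< U = set0 >] then 0 else rdiam U `^ s.

Definition hcover {R : realType} {m : nat} (delta : R) (E : set 'rV[R]_m)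
  (U : nat -> set 'rV[R]_m) : Prop :=
  E `<=` \bigcup_i U i /\ forall i x y, U i x -> U i y -> edist x y <= delta.

Definition Hdelta {R : realType} {m : nat} (s delta : R) (E : set 'rV[R]_m) : \bar R :=
  ereal_inf [set (\sum_(0 <= i <oo) (hterm s (U i))%:E)%E | U in hcover delta E].

Definition Hmeas {R : realType} {m : nat} (s : R) (E : set 'rV[R]_m) : \bar R :=
  ereal_sup [set Hdelta s delta E | delta in [set d : R | 0 < d]].

Definition dimH_set {R : realType} {m : nat} (E : set 'rV[R]_m) : \bar R :=
  ereal_inf [set s%:E | s in [set s : R | 0 <= s /\ Hmeas s E = 0%E]].

Definition dimH {R : realType} {m : nat} (mu : probability (Rm R m) R) : \bar R :=
  ereal_inf [set dimH_set E | E in [set E : set (Rm R m) | measurable E /\ mu E = 1%E]].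

Definition Dr_lim {R : realType} {m : nat} (mu : probability (Rm R m) R) (d : R) : Prop :=
  exists eps : R, 0 < eps /\ exists Dr : R -> R,
    (forall r, 0 < r < eps -> has_Dr mu r (Dr r)) /\ Dr r @[r --> 0^'+] --> d.

Definition Omega0 {R : realType} {m : nat} (mu : probability (Rm R m) R) : Prop :=
  in_Omega mu /\ exists d : R, Dr_lim mu d /\ has_D0 mu d /\ dimH mu = d%:E.

Definition Omega0gt {R : realType} {m : nat} (mu : probability (Rm R m) R) : Prop :=
  in_Omega mu /\ exists d : R, Dr_lim mu d /\ has_D0 mu d /\ (dimH mu < d%:E)%E.

(* Main.v *)
(** Rounding coordinates gives a finite-valued map [S] with [S x] close to [x] in mean, so it suffices to
perturb the finitely supported law of [S x].  The unperturbed law has all its dimensions equal to 0, which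
settles the first set.  For the second one we add [delta * f t] to the first coordinate of [S x], where [t]
is uniform on [[0, 1]] and independent of [x], and the law of [f t] has [D_r = D_0 = 1] but Hausdorff
dimension at most 1/2.

The map [f] sets to 0 the binary digits of [t] in the window [(N_j, 4 N_j]] whenever [t] lies in the dyadic
interval [F_j], where [F_0, F_1, ...] enumerates the dyadic intervals generation after generation.
- Every [t] lies in one [F_j] of each generation, so for each generation the range of [f] is covered by the
  intervals of length about [2^(-4 N_j)] around the points of the grid [2^(-N_j) Z], [j] in that generation;
  this bounds the Hausdorff dimension (even by 1/4).
- The measure of [F_j] tends to 0 and [N_j] grows faster than geometrically.  Up to the choice of the erased
  digits, which only takes [2^(lost J)] values, [f] is a translation at scales above [2^(-N_J)].  Hence the
  union of [n] balls of radius [2^(-u)] has mass at most [O(n 2^(lost J - u))], up to the mass of one [F_J],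
  and summing over [u] gives [- int log d(y, A) <= (1 + o(1)) log n] for every codebook [A] of size [n].
- Conversely the support is covered by [n] intervals of length [O(1/n)], so [D_0 = 1]; the bound on
  [int d(y, A)^r] follows from the logarithmic one by convexity, so [D_r = 1] for every [r]. *)

From HB Require Import structures.
From mathcomp Require Import all_boot all_order all_algebra.
From mathcomp Require Import all_classical all_reals all_analysis.
From mathcomp Require Import measurable_realfun.
From mathcomp Require Import ring lra zify.
Require Import Defs.
Set Implicit Arguments. Unset Strict Implicit. Unset Printing Implicit Defensive.
Import Order.TTheory GRing.Theory Num.Theory.
Import numFieldNormedType.Exports.
Local Open Scope classical_set_scope.
Local Open Scope ring_scope.

(** * The digit-erasing map *)

(* [win j] is the start N_j of the window, [lost j] the total length of the windows before it. *)
Fixpoint win (j : nat) : nat := if j is i.+1 then ((i + 8) * win i)%N else 128%N.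

Fixpoint lost (j : nat) : nat := if j is i.+1 then (lost i + 3 * win i)%N else 0%N.

Lemma winS j : win j.+1 = ((j + 8) * win j)%N. Proof. by []. Qed.

Lemma lostS j : lost j.+1 = (lost j + 3 * win j)%N. Proof. by []. Qed.

Lemma win_ge j : (128 + j <= win j)%N.
Proof. by elim: j => // j IH; rewrite winS; nia. Qed.

Lemma win_ge_double j : (j.+1.*2 <= win j)%N.
Proof. by elim: j => // j IH; rewrite winS; nia. Qed.

(** The quarter [k] of [win j] is the room left when fewer than [k] digits go to the size of the
    codebook and at most [2 * k] were erased earlier. *)
Lemma win_mul4 j : exists2 k, win j = (4 * k)%N & (32 <= k)%N.
Proof.
elim: j => [|j [k kE k32]]; first by exists 32.
by exists ((j + 8) * k)%N; rewrite ?winS ?kE; nia.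
Qed.

Lemma lost_le_win j : (2 * lost j <= win j)%N.
Proof. by elim: j => // j IH; rewrite winS lostS; have := win_ge j; nia. Qed.

Lemma lostS_le j : (lost j.+1 <= 4 * win j)%N.
Proof. by rewrite lostS; have := lost_le_win j; lia. Qed.

(** Window [i] ends at [4 * win i], so the windows are disjoint. *)
Lemma win_mono4 i j : (i < j)%N -> (4 * win i < win j)%N.
Proof.
elim: j => // j IH; rewrite ltnS leq_eqVlt winS => /predU1P[->|/IH]; have := win_ge j; nia.
Qed.

Lemma win_mono i j : (i <= j)%N -> (win i <= win j)%N.
Proof. by rewrite leq_eqVlt => /predU1P[->//|/win_mono4]; lia. Qed.

(** The constant is 12 * 16^2: it makes [6 * dy k] at most 1 / ((u + 1)(u + 2)) whenever u + 1 <= 16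
    k^2. *)
Lemma quartic_le_exp2 k : (32 <= k)%N -> (3072 * k ^ 4 <= 2 ^ k)%N.
Proof.
have step x : (32 <= x)%N -> (x.+1 ^ 4 <= 2 * x ^ 4)%N.
  move=> hx; have sq y : (y ^ 4 = y * y * (y * y))%N by rewrite !expnS expn0 muln1 !mulnA.
  (* 7/5 is below the square root of 2; squaring gives the factor 49/25 for fourth powers. *)
  have h : (5 * (x.+1 * x.+1) <= 7 * (x * x))%N by nia.
  rewrite !sq; move: (x.+1 * x.+1)%N (x * x)%N h => p q h.
  by have := leq_mul h h; rewrite mulnACA [leqRHS]mulnACA; move: (p * p)%N (q * q)%N; lia.
have base : (3072 * 32 ^ 4 <= 2 ^ 32)%N.
  have e1 : (32 ^ 4 = 2 ^ 20)%N := esym (expnM 2 5 4).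
  have e2 : (2 ^ 32 = 2 ^ 12 * 2 ^ 20)%N := expnD 2 12 20.
  rewrite e1 e2; apply: leq_mul; [exact: erefl | exact: leqnn].
move=> /subnK <-; elim: (k - 32)%N => [|i IH]; first exact: base.
rewrite addSn [in leqRHS]expnS; apply: leq_trans (leq_mul (leqnn 2) IH).
by rewrite [leqRHS]mulnCA; apply: leq_mul; [exact: leqnn | apply: step; exact: leq_addl].
Qed.

Section Dyadic.
Context {R : realType}.
Implicit Types (t : R) (j k n : nat).

Definition dy k : R := 2^-1 ^+ k.

Lemma dy_gt0 k : 0 < dy k. Proof. by rewrite exprn_gt0// invr_gt0. Qed.

Lemma dyE k : dy k = (2 ^+ k)^-1. Proof. by rewrite /dy exprVn. Qed.

Lemma dyS k : dy k = 2 * dy k.+1.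
Proof. by rewrite /dy exprS mulrA mulfV ?mul1r. Qed.

Lemma dyD k n : dy (k + n) = dy k * dy n. Proof. by rewrite /dy exprD. Qed.

Lemma le_dy k n : (k <= n)%N -> dy n <= dy k.
Proof. by move=> kn; rewrite /dy ler_wiXn2l// ?invr_ge0// invf_le1// ler1n. Qed.

Lemma exp2_dy k : 2 ^+ k * dy k = 1.
Proof. by rewrite dyE mulfV// expf_neq0. Qed.

Lemma dy_split k n : (k <= n)%N -> dy k = 2 ^+ (n - k) * dy n.
Proof. by move=> kn; rewrite -[in dy n](subnK kn) dyD mulrA exp2_dy mul1r. Qed.

(** Truncation of [t] after [k] binary digits. *)
Definition fl k t : R := (Num.floor (2 ^+ k * t))%:~R * dy k.

Lemma fl_le k t : fl k t <= t.
Proof.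
by rewrite /fl dyE ler_pdivrMr ?exprn_gt0// mulrC floor_le.
Qed.

Lemma fl_gt k t : t < fl k t + dy k.
Proof.
rewrite -[X in _ + X]mul1r -mulrDl dyE ltr_pdivlMr ?exprn_gt0// mulrC.
by rewrite -[1]/(1%:~R) -intrD floorD1_gt.
Qed.

Lemma fl_mono k n t : (k <= n)%N -> fl k t <= fl n t.
Proof.
move=> kn; have nE : n = (n - k + k)%N by rewrite subnK.
rewrite /fl (dy_split kn) mulrA ler_pM2r ?dy_gt0//.
have -> : (2 ^+ (n - k) : R) = (2 ^+ (n - k))%:~R by rewrite rmorphXn.
rewrite -intrM ler_int floor_ge_int intrM rmorphXn /= [in leRHS]nE exprD.
by rewrite mulrC -mulrA ler_pM2l ?exprn_gt0// floor_le.
Qed.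

(* The number with the digits of [t] in the window [(win j, 4 * win j]] and zeros elsewhere. *)
Definition wd j t : R := fl (4 * win j) t - fl (win j) t.

Lemma wd_ge0 j t : 0 <= wd j t.
Proof. by rewrite subr_ge0 fl_mono//; lia. Qed.

Lemma wd_lt j t : wd j t < dy (win j).
Proof.
rewrite /wd; have := fl_le (4 * win j) t; have := fl_gt (win j) t; lra.
Qed.

(** [v] is the block of digits in the window, read as a binary integer. *)
Lemma wd_digits j t : exists2 v : nat, (v < 2 ^ (3 * win j))%N & wd j t = v%:R * dy (4 * win j).
Proof.
have E : wd j t = (Num.floor (2 ^+ (4 * win j) * t)
    - 2 ^+ (3 * win j) * Num.floor (2 ^+ win j * t))%:~R * dy (4 * win j).
  rewrite /wd /fl intrD mulrDl intrN mulNr intrM rmorphXn /=; congr (_ - _).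
  rewrite (_ : (4 * win j = 3 * win j + win j)%N); last by lia.
  by rewrite dyD [RHS]mulrACA exp2_dy mul1r.
set z := (X in X%:~R * _) in E.
have z0 : 0 <= z.
  by have := wd_ge0 j t; rewrite E pmulr_lge0 ?dy_gt0// ler0z.
exists (absz z); last by rewrite E -{1}(gez0_abs z0).
have := wd_lt j t; rewrite E -{1}(gez0_abs z0).
rewrite (_ : dy (win j) = (2 ^ (3 * win j))%N%:R * dy (4 * win j)); last first.
  rewrite (_ : (4 * win j = 3 * win j + win j)%N); last by lia.
  by rewrite dyD mulrA natrX exp2_dy mul1r.
by rewrite ltr_pM2r ?dy_gt0// pmulrn ltr_nat.
Qed.

(* [t] lies in the dyadic interval F_j: index [j] is interval [j + 1 - 2^p] of generation
   [p = trunc_log 2 (j + 1)]. *)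
Definition dip j t : bool :=
  Num.floor (2 ^+ trunc_log 2 j.+1 * t) + (2 ^ trunc_log 2 j.+1)%N == j.+1.

(** The erasure stopped after [J] windows; as these are disjoint, subtracting their contents clears
    the digits. *)
Definition fpart J t : R := t - \sum_(i < J) (dip i t)%:R * wd i t.

Lemma fpart0 t : fpart 0 t = t. Proof. by rewrite /fpart big_ord0 subr0. Qed.

Lemma fpartS J t : fpart J.+1 t = fpart J t - (dip J t)%:R * wd J t.
Proof. by rewrite /fpart big_ord_recr /= opprD addrA. Qed.

Lemma fpart_step J t : 0 <= fpart J t - fpart J.+1 t <= dy (win J).
Proof.
rewrite fpartS; have := wd_ge0 J t; have := wd_lt J t; case: dip => /=; have := dy_gt0 (win J); lra.
Qed.

(** A geometric sum: [dy (win j)] at least halves at each step. The subtracted [dy (win K)] makes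
    the induction close. *)
Lemma fpart_tail J K t : (J <= K)%N ->
  0 <= fpart J t - fpart K t <= 2 * (dy (win J) - dy (win K)).
Proof.
move=> /subnK <-; elim: (K - J)%N => [|n IH]; first by rewrite add0n; lra.
rewrite addSn; have := fpart_step (n + J) t.
have : 2 * dy (win (n + J).+1) <= dy (win (n + J)).
  by rewrite (dyS (win (n + J))) ler_pM2l// le_dy//; have := win_mono4 (ltnSn (n + J)); lia.
lra.
Qed.

Lemma fpart_cvg t : fpart ^~ t @ \oo --> inf (range (fpart ^~ t)).
Proof.
apply: nonincreasing_cvgn => [J K JK|].
  by have := fpart_tail t JK; lra.
exists (fpart 0 t - 2 * dy (win 0)) => _ [K _ <-] /=.
by have := fpart_tail t (leq0n K); have := dy_gt0 (win K); lra.
Qed.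

Definition unit_dom t : bool := 0 <= t < 1.

(** [fpart J t] decreases in [J], so the infimum is its limit. The value 0 outside [0, 1) keeps the
    map bounded everywhere. *)
Definition fcantor t : R := if unit_dom t then inf (range (fpart ^~ t)) else 0.

Lemma fcantor_tail J t : unit_dom t -> 0 <= fpart J t - fcantor t <= 2 * dy (win J).
Proof.
move=> tI; rewrite /fcantor tI; have cv := @fpart_cvg t.
rewrite -(cvg_lim _ cv)//; have {}cv : cvgn (fpart ^~ t) by apply: cvgP cv.
rewrite subr_ge0 lerBlDl -lerBlDr; apply/andP; split.
  by apply: limr_le => //; exists J => // K /= JK; have := fpart_tail t JK; lra.
apply: limr_ge => //; exists J => // K /= JK; have := fpart_tail t JK.
by have := dy_gt0 (win K); lra.
Qed.

Lemma dy_win_le j : dy (win j) <= 2^-1 / 2.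
Proof.
have := @le_dy 2 (win j); rewrite {2}/dy expr2; apply.
by have := win_ge j; lia.
Qed.

Lemma fcantor_bounds t : -1 <= fcantor t < 1.
Proof.
have [tI|tI] := boolP (unit_dom t); last by rewrite /fcantor (negbTE tI); lra.
have := fcantor_tail 0 tI; rewrite fpart0; move: tI => /andP[].
have := dy_win_le 0; lra.
Qed.

(* The possible values of [t - fpart J t], i.e. of the erased digits. *)
Fixpoint offs J : seq R := if J is K.+1 then
    [seq o + v%:R * dy (4 * win K) | o <- offs K, v <- iota 0 (2 ^ (3 * win K))]
  else [:: 0].

Lemma size_offs J : size (offs J) = (2 ^ lost J)%N.
Proof. by elim: J => // J IH; rewrite [LHS]size_allpairs IH size_iota -expnD. Qed.

Lemma mem_offs J t : t - fpart J t \in offs J.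
Proof.
elim: J => [|J IH]; first by rewrite fpart0 subrr inE.
rewrite fpartS opprB addrCA addrC.
have [v vlt vE] := wd_digits J t.
case: (dip J t); rewrite /= ?mul1r ?mul0r.
  by apply/allpairsP; exists (t - fpart J t, v); split => //=; rewrite ?mem_iota ?vE.
apply/allpairsP; exists (t - fpart J t, 0%N); split => //=; last by rewrite mul0r.
by rewrite mem_iota expn_gt0.
Qed.

(** Outside F_J the window [J] is kept, which saves a factor [2 ^ (3 * win J)] in the number of
    offsets. *)
Lemma mem_offs_nodip J t : ~~ dip J t -> t - fpart J.+1 t \in offs J.
Proof. by move=> /negbTE nd; rewrite fpartS nd mul0r subr0 mem_offs. Qed.

(** The intervals of generation [p] tile [0, 1) and are numbered from [2 ^ p - 1] on, whence the
    [.-1] in the witness. *)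
Lemma dip_ex p t : unit_dom t ->
  exists2 j, (2 ^ p <= j.+1 < 2 ^ p.+1)%N & dip j t.
Proof.
move=> /andP[t0 t1].
have f0 : 0 <= Num.floor (2 ^+ p * t) by rewrite floor_ge0 mulr_ge0// exprn_ge0.
have fl : Num.floor (2 ^+ p * t) < (2 ^ p)%N :> int.
  rewrite floor_lt_int /= -pmulrn natrX -[ltRHS]mulr1 ltr_pM2l ?exprn_gt0//.
move: f0 fl; case E : (Num.floor _) => [k|//] _; rewrite ltz_nat => kp.
have p0 : (0 < 2 ^ p)%N by rewrite expn_gt0.
have kj : (k + 2 ^ p).-1.+1 = (k + 2 ^ p)%N by lia.
have b : (2 ^ p <= (k + 2 ^ p).-1.+1 < 2 ^ p.+1)%N by rewrite kj expnS; lia.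
by exists (k + 2 ^ p).-1 => //; rewrite /dip (trunc_log_eq _ b)// E kj.
Qed.

Lemma wd_grid i j t : (i < j)%N -> exists z : int, wd i t = z%:~R * dy (win j).
Proof.
move=> ij; have [v _ ->] := wd_digits i t.
have h := ltnW (win_mono4 ij).
exists (v * 2 ^ (win j - 4 * win i))%N.
by rewrite -pmulrn natrM natrX (dy_split h) mulrA.
Qed.

(** All windows before [j] end before position [win j], so the digits erased there lie on the grid
    of step [dy (win j)]. *)
Lemma fpart_grid j t : exists z : int, t - fpart j t = z%:~R * dy (win j).
Proof.
rewrite /fpart opprB addrC subrK.
apply: (big_ind (fun x : R => exists z : int, x = z%:~R * dy (win j))).
- by exists 0; rewrite mul0r.
- by move=> _ _ [z ->] [z' ->]; exists (z + z'); rewrite intrD mulrDl.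
- move=> i _; have [z ->] := wd_grid t (ltn_ord i).
  by exists ((dip i t)%:R * z); rewrite intrM mulrA; case: dip.
Qed.

(** On F_j the window [j] is cleared: what remains is a grid point, a tail of [t] below
    [dy (4 * win j)], and later erasures that total no more than that. *)
Lemma dip_near_grid j t : unit_dom t -> dip j t ->
  exists2 g : nat, (g <= 2 ^ (win j).+1)%N &
    `|fcantor t - (g%:R * dy (win j) - 1)| <= dy (4 * win j).
Proof.
move=> tI dj.
have [z zE] := fpart_grid j t.
(* The grid point is [t] truncated at [win j], minus the digits erased in earlier windows. *)
pose y : int := Num.floor (2 ^+ win j * t) - z.
have yE : fl (win j) t - (t - fpart j t) = y%:~R * dy (win j).
  by rewrite zE /fl /y intrB mulrBl.
have h1 := fl_le (4 * win j) t; have h2 := fl_gt (4 * win j) t.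
have h3 := fcantor_tail j.+1 tI.
have h4 : 2 * dy (win j.+1) <= dy (4 * win j).
  by rewrite [leRHS]dyS ler_pM2l// le_dy//; have := win_mono4 (ltnSn j); lia.
have h5 := fpartS j t; rewrite dj mul1r /wd in h5.
have near : `|fcantor t - y%:~R * dy (win j)| <= dy (4 * win j).
  by rewrite -yE ler_norml; apply/andP; split; lra.
have h6 := fpart_tail t (leq0n j); rewrite fpart0 in h6.
have h7 := fl_le (win j) t.
have h8 := fl_mono t (leq0n (win j)).
have h9 : 0 <= fl 0 t.
  by rewrite /fl mulr_ge0 ?(ltW (dy_gt0 _))// ler0z floor_ge0 expr0 mul1r; case/andP: tI.
have h10 := dy_win_le 0; have h11 := dy_gt0 (win j).
case/andP: tI => t0 t1.
have b1 : - 1 <= y%:~R * dy (win j) by rewrite -yE; lra.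
have b2 : y%:~R * dy (win j) <= 1 by rewrite -yE; lra.
have nX : ((2 ^ win j)%N%:~R : R) * dy (win j) = 1 by rewrite -pmulrn natrX exp2_dy.
have y1 : 0 <= y + (2 ^ win j)%N.
  by rewrite -(ler0z R) -(pmulr_lge0 _ h11) intrD mulrDl nX; lra.
have y2 : y <= (2 ^ win j)%N by rewrite -(ler_int R) -(ler_pM2r h11) nX.
have yX : Posz (absz (y + (2 ^ win j)%N)) = y + (2 ^ win j)%N by exact: gez0_abs.
(* [y] may be negative; adding [2 ^ win j], that is 1 on the grid, makes it a natural number. *)
exists (absz (y + (2 ^ win j)%N)); last first.
  by rewrite pmulrn yX intrD mulrDl nX addrK.
by rewrite expnS mul2n -addnn -lez_nat yX PoszD lerD2r.
Qed.

End Dyadic.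

(** * Concentration of the law of the map *)

Lemma win_between u : (128 <= u)%N -> exists j, (win j <= u < win j.+1)%N.
Proof.
move=> u128; have ex : exists j, (u < win j.+1)%N by exists u; have := win_ge u.+1; lia.
exists (ex_minn ex); case: ex_minnP => -[|j] uj minj; first by rewrite uj andbT.
by rewrite uj andbT leqNgt; apply/negP => /minj; rewrite ltnn.
Qed.

Section UniformLaw.
Context {R : realType}.
Local Notation mu := (@lebesgue_measure R).
Implicit Types (s As : seq R) (t a : R) (u U J K : nat).

Definition unif : probability (measurableTypeR R) R := uniform_prob (@ltr01 R).

Lemma unif_le (A B : set R) : measurable A -> measurable B ->
  (forall t, unit_dom t -> A t -> B t) -> (unif A <= mu B)%E.
Proof.
move=> mA mB AB; rewrite /unif /= /uniform_prob integral_uniform_pdf.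
have mA1 : measurable (A `&` `[0, 1]) by exact: measurableI.
apply: (@le_trans _ _ (\int[mu]_(x in A `&` `[0%R, 1%R]) (cst 1 x))%E).
  apply: ge0_le_integral => //.
  - by move=> x _; rewrite lee_fin uniform_pdf_ge0.
  - by apply/measurable_EFinP/measurable_funTS; exact: measurable_uniform_pdf.
  - by move=> x [_]; rewrite /= in_itv /= /uniform_pdf => ->; rewrite subr0 invr1.
rewrite integral_cst// mul1e.
(* [uniform_prob] lives on the closed interval; its endpoint 1 is outside [unit_dom] and is added as
   a null set. *)
apply: (@le_trans _ _ (mu (B `|` [set 1]))).
  apply: le_measure; rewrite ?inE//; first exact: measurableU.
  move=> t [At] /=; rewrite in_itv /= => /andP[t0]; rewrite le_eqVlt => /predU1P[->|t1]; first by right.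
  by left; apply: AB => //; rewrite /unit_dom t0.
apply: le_trans (measureU2 _ _ _) _ => //.
by rewrite [X in (_ + X)%E](_ : _ = 0%E) ?adde0//; exact: lebesgue_measure_set1.
Qed.

Definition near_seq s (r : R) : set R := [set t | has (fun a => `|t - a| < r) s].

Lemma near_seq_cons a s r : near_seq (a :: s) r = ball a r `|` near_seq s r.
Proof.
by apply/seteqP; split => t /=; rewrite /near_seq /= /ball /= distrC => /orP.
Qed.

Lemma measurable_near_seq s r : measurable (near_seq s r).
Proof.
elim: s => [|a s IH]; last by rewrite near_seq_cons; apply: measurableU => //; exact: measurable_ball.
by rewrite (_ : near_seq _ _ = set0)//; apply/seteqP; split.
Qed.

Lemma near_seq_le s r : 0 <= r -> (mu (near_seq s r) <= ((size s)%:R * (2 * r))%:E)%E.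
Proof.
move=> r0; elim: s => [|a s IH].
  by rewrite (_ : near_seq _ _ = set0) ?measure0 ?mul0r//; apply/seteqP; split.
rewrite near_seq_cons; apply: le_trans (measureU2 _ _ _) _; [exact: measurable_ball|exact: measurable_near_seq|].
apply: le_trans (leeD2l _ IH) _.
rewrite [X in (X + _)%E](_ : _ = (r *+ 2)%:E); last exact: lebesgue_measure_ball.
by rewrite -EFinD lee_fin /= -natr1 -mulr_natl; lra.
Qed.

Lemma measurable_fl k : measurable_fun setT (fl k : R -> R).
Proof.
apply: nondecreasing_measurable => // x y xy.
by rewrite /fl ler_pM2r ?dy_gt0// ler_int le_floor// ler_pM2l ?exprn_gt0.
Qed.

Lemma dip_itv j : exists c : R, [set t : R | dip j t] =
  `[c, c + dy (trunc_log 2 j.+1)[%classic.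
Proof.
set p := trunc_log 2 j.+1; set z : int := j.+1%:Z - (2 ^ p)%N%:Z.
exists (z%:~R * dy p).
have E t : dip j t = (z%:~R * dy p <= t < z%:~R * dy p + dy p).
  rewrite /dip -/p eq_sym -subr_eq eq_sym -/z floor_eq intrD.
  rewrite -[X in _ = (_ <= _ < _ + X)]mul1r -mulrDl dyE ler_pdivrMr ?ltr_pdivlMr ?exprn_gt0//.
  by rewrite [t * _]mulrC.
by apply/seteqP; split => t /=; rewrite in_itv /= E.
Qed.

Lemma measurable_dip j : measurable [set t : R | dip j t].
Proof. by have [c ->] := dip_itv j. Qed.

Lemma dip_le j : (mu [set t : R | dip j t] <= (dy (trunc_log 2 j.+1))%:E)%E.
Proof.
have [c ->] := dip_itv j; rewrite [leLHS]lebesgue_measure_itv /= lte_fin ltrDl dy_gt0.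
by rewrite -EFinD addrAC subrr add0r.
Qed.

Lemma measurable_unit_dom : measurable [set t : R | unit_dom t].
Proof.
by rewrite (_ : [set t | _] = `[0, 1[%classic)//; apply/seteqP; split => t /=; rewrite in_itv.
Qed.

Lemma measurable_fpart J : measurable_fun setT (fpart J : R -> R).
Proof.
elim: J => [|J IH].
  by rewrite (_ : fpart 0 = id) //; apply/funext => t; rewrite fpart0.
rewrite (_ : fpart J.+1 = fun t => fpart J t - \1_[set t | dip J t] t * wd J t); last first.
  by apply/funext => t; rewrite fpartS indicE mem_setE.
apply: measurable_funB => //; apply: measurable_funM.
  by apply: measurable_indic; exact: measurable_dip.
by apply: measurable_funB; exact: measurable_fl.
Qed.

Lemma measurable_fcantor : measurable_fun setT (fcantor : R -> R).
Proof.
rewrite (_ : fcantor = fun t => \1_[set t | unit_dom t] t * inf (range (fpart ^~ t))); last first.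
  apply/funext => t; rewrite /fcantor indicE.
  have [tI|tI] := boolP (unit_dom t); first by rewrite mem_set// mul1r.
  by rewrite memNset ?mul0r//; exact/negP.
apply: measurable_funM; first by apply: measurable_indic; exact: measurable_unit_dom.
apply: (@measurable_fun_cvg _ _ _ _ (fun J t => fpart J t)) => [J|t _].
  exact: measurable_fpart.
exact: fpart_cvg.
Qed.

(** The masses of these events, summed over [u], control the mean of -log2 of the distance from
    [fcantor t] to [As]. *)
Definition hit As u : set R := [set t | has (fun a => `|fcantor t - a| < dy u) As].

Lemma measurable_hit As u : measurable (hit As u).
Proof.
have := measurable_fcantor measurableT (measurable_near_seq As (dy u)).
by rewrite setTI.
Qed.

(** [fcantor t] is [t] minus its offset up to [2 * dy (win J)], hence up to [2 * dy u]; the radius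
    [dy u] makes it [3 * dy u]. *)
Lemma hit_near s As J u t : (u <= win J)%N -> unit_dom t -> t - fpart J t \in s ->
  hit As u t -> near_seq [seq a + o | a <- As, o <- s] (3 * dy u) t.
Proof.
move=> uJ tI ts /hasP[a aA ta]; apply/hasP.
exists (a + (t - fpart J t)); first exact: allpairs_f.
have := fcantor_tail J tI; have := le_dy (R := R) uJ; move: ta; rewrite !ltr_norml; lra.
Qed.

(** Counting intervals: one of length [6 * dy u] for each point of [As] and each offset. *)
Lemma hit_le As J u : (u <= win J)%N ->
  (unif (hit As u) <= ((size As * 2 ^ lost J)%N%:R * (6 * dy u))%:E)%E.
Proof.
move=> uJ; pose s := [seq a + o | a <- As, o <- offs J].
apply: (@le_trans _ _ (mu (near_seq s (3 * dy u)))).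
  apply: unif_le => [||t tI ht]; [exact: measurable_hit|exact: measurable_near_seq|].
  by apply: (hit_near uJ) ht => //; exact: mem_offs.
apply: le_trans (near_seq_le _ _) _; first by rewrite mulr_ge0// ltW// dy_gt0.
by rewrite lee_fin size_allpairs size_offs (_ : 2 * (3 * dy u) = 6 * dy u)//; ring.
Qed.

(** Scales as fine as [dy (win J.+1)] are reached with the offsets of the first [J] windows only, at
    the price of the mass of F_J. *)
Lemma hit_nodip_le As J u : (u <= win J.+1)%N ->
  (unif (hit As u) <= (dy (trunc_log 2 J.+1) + (size As * 2 ^ lost J)%N%:R * (6 * dy u))%:E)%E.
Proof.
move=> uJ; pose s := [seq a + o | a <- As, o <- offs J].
apply: (@le_trans _ _ (mu ([set t | dip J t] `|` near_seq s (3 * dy u)))).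
  apply: unif_le => [||t tI ht]; [exact: measurable_hit| |].
    by apply: measurableU; [exact: measurable_dip|exact: measurable_near_seq].
  have [dt|dt] := boolP (dip J t); [by left|right].
  by apply: (hit_near uJ) ht => //; exact: mem_offs_nodip.
apply: le_trans (measureU2 _ _ _) _; [exact: measurable_dip|exact: measurable_near_seq|].
rewrite EFinD; apply: leeD; first exact: dip_le.
apply: le_trans (near_seq_le _ _) _; first by rewrite mulr_ge0// ltW// dy_gt0.
by rewrite lee_fin size_allpairs size_offs (_ : 2 * (3 * dy u) = 6 * dy u)//; ring.
Qed.

Lemma sum_indic_lt X K : \sum_(u < K) (u < X)%N%:R <= X%:R :> R.
Proof.
suff -> : \sum_(u < K) (u < X)%N%:R = (minn K X)%:R :> R by rewrite ler_nat geq_minr.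
elim: K => [|K IH]; first by rewrite big_ord0 min0n.
by rewrite big_ord_recr /= IH -natrD; congr (_%:R); case: ltnP; lia.
Qed.

Lemma sum_dy_le X K : \sum_(u < K) (X <= u)%N%:R * dy (u - X) <= 2 :> R.
Proof.
suff : \sum_(u < K) (X <= u)%N%:R * dy (u - X) <= 2 - 2 * dy (K - X) :> R.
  by have := dy_gt0 (R := R) (K - X); lra.
elim: K => [|K IH]; first by rewrite big_ord0 sub0n /dy expr0; lra.
rewrite big_ord_recr /=; case: (leqP X K) IH => XK; last first.
  have /eqP -> : (K - X == 0)%N by rewrite subn_eq0 ltnW.
  have /eqP -> : (K.+1 - X == 0)%N by rewrite subn_eq0.
  by rewrite mul0r addr0.
by rewrite subSn// (dyS (K - X)) /=; lra.
Qed.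

Lemma sum_telescope_le K : \sum_(u < K) (u.+1%:R * u.+2%:R)^-1 <= 1 :> R.
Proof.
suff -> : \sum_(u < K) (u.+1%:R * u.+2%:R)^-1 = 1 - K.+1%:R^-1 :> R.
  by rewrite gerBl invr_ge0.
elim: K => [|K IH]; first by rewrite big_ord0 invr1 subrr.
have x0 : 0 < K.+1%:R :> R by [].
rewrite big_ord_recr /= IH -[K.+2%:R]natr1; move: (K.+1%:R) x0 => x x0.
by field; apply/andP; split; lra.
Qed.

(* Below scale [2^-(win J.+1)] the crude bound by all the windows up to [u] is already smaller than
   [1 / (u + 1)(u + 2)]. *)
Lemma hit_term_le As U J u : (size As <= 2 ^ U)%N -> (win J <= 4 * U < win J.+1)%N ->
  (unif (hit As u) <= ((u < U + lost J)%N%:R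
    + dy (trunc_log 2 J.+1) * (u < U + lost J.+1)%N%:R
    + 6 * ((U + lost J <= u)%N%:R * dy (u - (U + lost J)))
    + 6 * ((U + lost J.+1 <= u)%N%:R * dy (u - (U + lost J.+1)))
    + (u.+1%:R * u.+2%:R)^-1)%:E)%E.
Proof.
move=> sA /andP[JU UJ].
have dyu n X : (X <= n)%N -> (2 ^ X)%N%:R * dy n = dy (n - X) :> R.
  by move=> Xn; rewrite -{1}(subnKC Xn) dyD mulrA natrX exp2_dy mul1r.
have sAL X : (size As * 2 ^ X)%N%:R <= (2 ^ (U + X))%N%:R :> R.
  by rewrite ler_nat expnD leq_mul2r sA orbT.
have p6 : 0 <= 6 * dy u :> R by rewrite mulr_ge0// ltW// dy_gt0.
have q0 := dy_gt0 (R := R) (trunc_log 2 J.+1).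
have t0 : 0 <= (u.+1%:R * u.+2%:R)^-1 :> R by rewrite invr_ge0 mulr_ge0.
have a0 b : 0 <= dy (trunc_log 2 J.+1) * (b : bool)%:R :> R by rewrite mulr_ge0// ltW.
have c0 X b : 0 <= 6 * ((b : bool)%:R * dy X) :> R by rewrite !mulr_ge0// ltW// dy_gt0.
have mdy X : (U + X <= u)%N -> (size As * 2 ^ X)%N%:R * (6 * dy u) <= 6 * dy (u - (U + X)) :> R.
  by move=> /dyu <-; rewrite [leRHS]mulrCA; apply: ler_wpM2r.
have [uUL|ULu] := ltnP u (U + lost J).
  apply: le_trans (probability_le1 _ _) _; first exact: measurable_hit.
  by rewrite lee_fin -!addrA lerDl !addr_ge0.
have [uw|wu] := ltnP u (win J.+1).
  have [uUL'|ULu'] := ltnP u (U + lost J.+1).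
    apply: le_trans (hit_nodip_le _ (ltnW uw)) _; rewrite lee_fin add0r mulr1 -!addrA lerD2l.
    by rewrite mul1r; apply: ler_wpDr (mdy _ ULu); exact: addr_ge0.
  apply: le_trans (hit_le _ (ltnW uw)) _; rewrite lee_fin add0r mulr0 add0r.
  apply: ler_wpDr => //; apply: ler_wpDl => //; rewrite mul1r; exact: mdy.
(* Finer scales are coarsened to the last [win j <= u]. There [U < k] and [lost j <= 2 * k], so
   counting still gains [dy k]. *)
have [|j /andP[ju uj]] := @win_between u; first by have := win_ge J.+1; lia.
have Jj : (J < j)%N.
  by rewrite ltnNge; apply/negP => jJ; have := win_mono (i := j.+1) (j := J.+1) jJ; lia.
have := win_mono Jj; have [k kE k32] := win_mul4 j; have := lost_le_win j.
rewrite kE => lj wJ.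
have Uk : (U + lost j + k <= win j)%N by lia.
apply: (@le_trans _ _ (unif (hit As (win j)))).
  apply: le_measure; rewrite ?inE; [exact: measurable_hit|exact: measurable_hit|].
  move=> t /hasP[a aA ta]; apply/hasP; exists a => //.
  by apply: lt_le_trans ta _; exact: le_dy.
apply: le_trans (hit_le _ (leqnn _)) _; rewrite lee_fin.
apply: (@le_trans _ _ (6 * dy k)).
  rewrite mulrCA ler_pM2l//.
  apply: le_trans (ler_wpM2r (ltW (dy_gt0 _)) (sAL _)) _.
  by rewrite dyu; [apply: le_dy; lia|lia].
apply: (@le_trans _ _ (u.+1%:R * u.+2%:R)^-1); last first.
  by apply: ler_wpDl => //; rewrite !addr_ge0.
rewrite -div1r ler_pdivlMr ?mulr_gt0// dyE mulrAC ler_pdivrMr ?exprn_gt0// mul1r.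
rewrite -natrX -!natrM ler_nat.
apply: leq_trans (quartic_le_exp2 k32).
(* [win j.+1] is [(j + 8) * (4 * k)], and [j + 8 <= 4 * k]. *)
have uk : (u.+1 <= 16 * (k * k))%N.
  by apply: leq_trans uj _; rewrite winS kE; have := win_ge j; rewrite kE; nia.
have -> : (k ^ 4 = k * k * (k * k))%N by rewrite !expnS expn0 muln1 !mulnA.
have kk : (1024 <= k * k)%N by nia.
move: (k * k)%N uk kk => y uk kk.
clear -uk kk; nia.
Qed.

(** Indicators sum to their thresholds, each geometric tail to at most 2 and the telescoping series
    to at most 1. *)
Lemma hit_series_le As U J : (size As <= 2 ^ U)%N -> (win J <= 4 * U < win J.+1)%N ->
  (\sum_(0 <= u <oo) unif (hit As u) <= ((U + lost J)%:R
    + dy (trunc_log 2 J.+1) * (U + lost J.+1)%:R + 25)%:E)%E.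
Proof.
move=> sA UJ; apply: lime_le; first by apply: is_cvg_nneseries => n _ _; exact: measure_ge0.
near=> K; rewrite big_mkord.
apply: le_trans (lee_sum _ (fun (u : 'I_K) _ => hit_term_le u sA UJ)) _.
rewrite sumEFin lee_fin (_ : 25 = 6 * 2 + 6 * 2 + 1); last by ring.
rewrite !big_split -!mulr_sumr !addrA.
have q0 := dy_gt0 (R := R) (trunc_log 2 J.+1).
apply: lerD (sum_telescope_le K); apply: lerD; [apply: lerD; [apply: lerD|]|].
- exact: sum_indic_lt.
- by rewrite ler_pM2l//; exact: sum_indic_lt.
- by rewrite ler_pM2l//; exact: sum_dy_le.
- by rewrite ler_pM2l//; exact: sum_dy_le.
Unshelve. all: by end_near. Qed.

End UniformLaw.

(** * Asymptotics and logarithms *)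

Section Asymptotics.
Context {R : realType}.
Implicit Types (e c d r : R).

Lemma ln2_gt0 : 0 < ln 2 :> R. Proof. by rewrite ln_gt0 ?ltr1n. Qed.

Lemma ln_exp2 k : ln (2 ^+ k) = k%:R * ln 2 :> R.
Proof. by rewrite lnXn// mulr_natl. Qed.

Lemma ln_dy k : ln (dy k) = - (k%:R * ln 2) :> R.
Proof. by rewrite dyE lnV ?ln_exp2// posrE exprn_gt0. Qed.

(** The growing factor [j + 8] in [win] makes the erased digits a vanishing fraction of [win J]. *)
Lemma lost_win J : ((J + 7) * lost J <= 4 * win J)%N.
Proof. by case: J => [|J]//; rewrite winS; have := lostS_le J; nia. Qed.

Lemma dy_trunc_log J : dy (trunc_log 2 J.+1) <= 2 / J.+1%:R :> R.
Proof.
rewrite ler_pdivlMr// dyE mulrC ler_pdivrMr ?exprn_gt0// -exprS -natrX ler_nat.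
by apply: ltnW; exact: trunc_log_ltn.
Qed.

(** 50 = 16 + 2 * 17: [lost J] is at most [16 U / (J + 1)], and [U + lost J.+1 <= 17 U] has weight
    at most [2 / (J + 1)]. *)
Lemma hit_bound_le U J : (win J <= 4 * U)%N ->
  (U + lost J)%:R + dy (trunc_log 2 J.+1) * (U + lost J.+1)%:R + 25
    <= U%:R * (1 + 50 / J.+1%:R) + 25 :> R.
Proof.
move=> JU; rewrite lerD2r.
have J0 : 0 < J.+1%:R :> R by [].
have h1 : (lost J)%:R <= 16 * U%:R / J.+1%:R :> R.
  rewrite ler_pdivlMr// -!natrM ler_nat; have := lost_win J; nia.
have h2 : (U + lost J.+1)%:R <= 17 * U%:R :> R.
  by rewrite -natrM ler_nat; have := lostS_le J; lia.
have h3 : dy (trunc_log 2 J.+1) * (U + lost J.+1)%:R <= 2 / J.+1%:R * (17 * U%:R) :> R.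
  by apply: ler_pM; [exact: ltW (dy_gt0 _)|exact: ler0n|exact: dy_trunc_log|exact: h2].
rewrite natrD; apply: le_trans (lerD (lerD (lexx _) h1) h3) _.
by rewrite le_eqVlt; apply/orP; left; apply/eqP; field.
Qed.

(** [U] is the number of binary digits of [n], and [J] the window index reached by [4 * U]; both
    grow with [n]. The constant [c] will be [- ln delta]. *)
Lemma entropy_asymptotics c e : 0 < e -> \forall n \near \oo, exists U J : nat,
  [/\ (n <= 2 ^ U)%N, (win J <= 4 * U < win J.+1)%N &
   ln 2 * ((U + lost J)%:R + dy (trunc_log 2 J.+1) * (U + lost J.+1)%:R + 25) + c
     <= (1 + e) * ln n%:R].
Proof.
move=> e0; have l2 := ln2_gt0.
(* From [J0] on, [50 / (J + 1)] is at most [e / 2]. *)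
have [J0 J0P] : exists J0 : nat, 100 / e <= J0%:R.
  by exists (Num.truncn (100 / e)).+1; apply: ltW; rewrite truncnS_gt.
(* From [U0] on, [U * e / 2] absorbs 25, [c / ln 2], and the loss [1 + e] due to [ln n] being only
   at least [(U - 1) ln 2]. *)
have [U0 U0P] : exists U0 : nat, (26 + e + `|c| / ln 2) / (e / 2) <= U0%:R.
  by exists (Num.truncn ((26 + e + `|c| / ln 2) / (e / 2))).+1; apply: ltW; rewrite truncnS_gt.
pose N := maxn 32 (maxn U0 (win J0)).
exists (2 ^ N)%N => // n /= Nn.
have n0 : (0 < n)%N by apply: leq_trans Nn; rewrite expn_gt0.
have NT : (N <= trunc_log 2 n)%N by apply: trunc_log_max.
set U := (trunc_log 2 n).+1.
have [|J /andP[JU UJ]] := @win_between (4 * U); first by rewrite /U; move: NT; rewrite /N; lia.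
have J0J : (J0 <= J)%N.
  rewrite leqNgt; apply/negP => JJ0; have := win_mono JJ0; move: UJ NT; rewrite /U /N; lia.
exists U, J; split; [by apply: ltnW; exact: trunc_log_ltn|by rewrite JU UJ|].
have h := hit_bound_le JU.
have Ue : U%:R * (e / 2) >= 26 + e + `|c| / ln 2.
  rewrite -ler_pdivrMr ?divr_gt0//; apply: le_trans U0P _; rewrite ler_nat /U.
  by move: NT; rewrite /N; lia.
have Je : 50 / J.+1%:R <= e / 2.
  rewrite ler_pdivrMr// -ler_pdivrMl ?divr_gt0// invf_div mulrAC ler_pdivrMr//.
  have : J0%:R <= J.+1%:R :> R by rewrite ler_nat ltnW.
  move=> /(le_trans J0P); rewrite ler_pdivrMr//; lra.
have lnU : (U%:R - 1) * ln 2 <= ln n%:R :> R.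
  rewrite (_ : U%:R - 1 = (trunc_log 2 n)%:R); last by rewrite /U -addn1 natrD addrK.
  rewrite -ln_exp2 ler_ln ?posrE ?exprn_gt0 ?ltr0n// -natrX ler_nat.
  exact: trunc_logP.
have step : ln 2 * (U%:R * (1 + e / 2) + 25) + c <= (1 + e) * ((U%:R - 1) * ln 2) :> R.
  rewrite mulrA [leRHS]mulrC -lerBrDl.
  have cl : c <= ln 2 * (`|c| / ln 2) by rewrite mulrCA divff ?gt_eqF// mulr1 ler_norm.
  have : ln 2 * (26 + e + `|c| / ln 2) <= ln 2 * (U%:R * (e / 2)) by rewrite ler_pM2l.
  move: (`|c| / ln 2) cl => y cl; nra.
apply: le_trans (le_trans _ step) _.
  rewrite lerD2r ler_pM2l//; apply: le_trans h _; rewrite lerD2r.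
  by apply: ler_wpM2l => //; rewrite lerD2l.
by apply: ler_wpM2l lnU; lra.
Qed.

Lemma ratio_cvg (X : nat -> \bar R) r : 0 < r ->
  (forall e, 0 < e -> \forall n \near \oo,
     ((r * ((1 - e) * ln n%:R))%:E <= X n <= (r * ((1 + e) * ln n%:R))%:E)%E) ->
  ((r * ln n%:R)%:E * (X n)^-1)%E @[n --> \oo] --> (1 : R)%:E.
Proof.
move=> r0 H.
have Q e : 0 < e -> \forall n \near \oo,
    ((r * ln n%:R)%:E * (X n)^-1)%E \is a fin_num /\
    `|1 - fine ((r * ln n%:R)%:E * (X n)^-1)%E| <= e.
  (* [e' <= 1/2] keeps [X n] above half of [r * ln n], so an error [e / 2] relative to the latter is
     at most [e] relative to [X n]. *)
  move=> e0; pose e' := Num.min (2^-1) (e / 2).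
  have e'0 : 0 < e' by rewrite lt_min invr_gt0 divr_gt0//= ltr0n.
  have e'1 : e' <= 2^-1 by rewrite ge_min lexx.
  have e'2 : e' <= e / 2 by rewrite ge_min lexx orbT.
  near=> n.
  have l0 : 0 < ln n%:R :> R.
    by rewrite ln_gt0// ltr1n; near: n; exists 2.
  have : ((r * ((1 - e') * ln n%:R))%:E <= X n <= (r * ((1 + e') * ln n%:R))%:E)%E.
    by near: n; exact: H.
  case: (X n) => [x| |] /andP[]; rewrite ?leye_eq ?leeNy_eq ?lee_fin // => h1 h2.
  have y0 : 0 < r * ln n%:R by rewrite mulr_gt0.
  have x0 : 0 < x by apply: lt_le_trans h1; rewrite !mulr_gt0//; lra.
  rewrite inver gt_eqF// -EFinM /=; split=> //.
  rewrite (_ : 1 - _ = (x - r * ln n%:R) / x); last by field; rewrite gt_eqF.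
  rewrite normrM normfV (gtr0_norm x0) ler_pdivrMr//.
  move: y0 h1 h2; rewrite !(mulrCA r); move: (r * ln n%:R) => y y0 h1 h2.
  apply: (@le_trans _ _ (e' * y)); first by rewrite ler_norml; apply/andP; split; lra.
  apply: (@le_trans _ _ (e / 2 * y)); first by rewrite ler_pM2r.
  by rewrite -mulrA ler_pM2l//; nra.
apply/fine_cvgP; split.
  by apply: filterS (Q 1 ltr01) => n [].
by apply/cvgrPdist_le => e e0; apply: filterS (Q _ e0) => n [].
Unshelve. all: by end_near. Qed.

(** The negative part of [log d], with value [+oo] at 0. *)
Definition neglog d : \bar R := (maxe (- elog d%:E) 0)%E.

Lemma neglog_ge0 d : (0 <= neglog d)%E. Proof. by rewrite /neglog le_max lexx orbT. Qed.

(** If [K] is the first index with [c * dy K <= d], the series is at least [K], and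
    [- ln d <= - ln c + K ln 2]. For [d = 0] the series diverges. *)
Lemma neglog_layer_cake c d : 0 < c <= 1 -> 0 <= d ->
  (neglog d <= (- ln c)%:E + (ln 2)%:E * \sum_(0 <= u <oo) ((d < c * dy u)%R%:R)%:E)%E.
Proof.
move=> /andP[c0 c1]; have l2 := ln2_gt0.
have lc : 0 <= - ln c by rewrite oppr_ge0 ln_le0.
have S0 : (0 <= \sum_(0 <= u <oo) ((d < c * dy u)%R%:R)%:E :> \bar R)%E.
  by apply: nneseries_ge0 => u _ _; rewrite lee_fin.
have part K : (forall u, (u < K)%N -> d < c * dy u) ->
    ((K%:R : R)%:E <= \sum_(0 <= u <oo) ((d < c * dy u)%R%:R)%:E)%E.
  move=> dK; apply: (@le_trans _ _ (\sum_(0 <= u < K) ((d < c * dy u)%R%:R)%:E)%E); last first.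
    by apply: nneseries_lim_ge => u _ _; rewrite lee_fin.
  rewrite big_mkord (eq_bigr (fun=> 1%E)) => [|u _]; last by rewrite dK.
  by rewrite sumEFin lee_fin sumr_const card_ord.
rewrite le_eqVlt => /predU1P[d0|d0].
  rewrite -{}d0 in part *.
  rewrite (_ : \sum_(0 <= u <oo) _ = +oo)%E; last first.
    apply/eqyP => A A0; apply: le_trans (part (Num.truncn A).+1 _).
      by rewrite lee_fin ltW// truncnS_gt.
    by move=> u _; rewrite mulr_gt0// dy_gt0.
  by rewrite mulry gtr0_sg// mul1e addey ?leey.
have ex : exists K, c * dy K <= d.
  have [K hK] : exists K : nat, c / d <= K%:R.
    by exists (Num.truncn (c / d)).+1; apply: ltW; rewrite truncnS_gt.
  exists K; rewrite dyE ler_pdivrMr ?exprn_gt0// -ler_pdivrMl// mulrC.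
  apply: le_trans hK _; rewrite -natrX ler_nat ltnW//; exact: ltn_expl.
have [K KP Kmin] : exists2 K, c * dy K <= d & forall u, (u < K)%N -> d < c * dy u.
  exists (ex_minn ex); case: ex_minnP => K // KP Kmin u uK.
  by rewrite ltNge; apply/negP => /Kmin; rewrite leqNgt uK.
rewrite /neglog ge_max; apply/andP; split; last first.
  by rewrite adde_ge0 ?lee_fin// mule_ge0// lee_fin ltW.
apply: (@le_trans _ _ ((- ln c)%:E + (ln 2)%:E * K%:R%:E)%E); last first.
  by rewrite leeD2l// lee_pmul2l ?lte_fin// part.
rewrite /elog gt_eqF// -EFinM -EFinD -EFinN lee_fin.
have := KP; rewrite -ler_ln ?posrE ?mulr_gt0 ?dy_gt0// lnM ?posrE ?dy_gt0// ln_dy; lra.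
Qed.

(** The exponential lies above its tangent at [- r B]; this is evaluated at [r ln d]. *)
Lemma powR_tangent r B d : 0 < r -> 0 <= d ->
  ((expR (- (r * B)) * (1 + r * B))%:E <=
   (d `^ r)%:E + (expR (- (r * B)) * r)%:E * neglog d)%E.
Proof.
move=> r0; have E0 := expR_gt0 (- (r * B)).
rewrite le_eqVlt => /predU1P[<-|d0].
  rewrite /neglog /elog eqxx /= maxye mulry gtr0_sg ?mulr_gt0// mul1e addey ?leey//.
have nd : ((- ln d)%:E <= neglog d)%E by rewrite /neglog /elog gt_eqF// le_max lexx.
apply: (@le_trans _ _ ((d `^ r)%:E + (expR (- (r * B)) * r)%:E * (- ln d)%:E)%E); last first.
  by rewrite leeD2l// lee_pmul2l// lte_fin mulr_gt0.
rewrite -EFinM -EFinD lee_fin /powR gt_eqF//.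
have -> : r * ln d = - (r * B) + (r * ln d + r * B) by ring.
rewrite expRD; have := expR_ge1Dx (r * ln d + r * B).
move=> /(ler_wpM2l (ltW E0)); lra.
Qed.

End Asymptotics.

(** * Euclidean distance and Hausdorff measure *)

Section Euclidean.
Context {R : realType} {m : nat}.
Implicit Types (x y z a : 'rV[R]_m) (A : seq 'rV[R]_m).

(** Lagrange's identity: the double sum of squares is twice the difference of the two sides. *)
Lemma cauchy_schwarz (I : finType) (f g : I -> R) :
  (\sum_i f i * g i) ^+ 2 <= (\sum_i f i ^+ 2) * (\sum_i g i ^+ 2).
Proof.
have h : 0 <= \sum_i \sum_j (f i * g j - f j * g i) ^+ 2.
  by apply: sumr_ge0 => i _; apply: sumr_ge0 => j _; exact: sqr_ge0.
have E : \sum_i \sum_j (f i * g j - f j * g i) ^+ 2 =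
    2 * ((\sum_i f i ^+ 2) * (\sum_i g i ^+ 2)) - 2 * (\sum_i f i * g i) ^+ 2.
  have e1 : (\sum_i f i ^+ 2) * (\sum_i g i ^+ 2) = \sum_i \sum_j f i ^+ 2 * g j ^+ 2.
    by rewrite big_distrl /=; apply: eq_bigr => i _; rewrite big_distrr.
  have e2 : (\sum_i f i * g i) ^+ 2 = \sum_i \sum_j (f i * g i) * (f j * g j).
    by rewrite expr2 big_distrl /=; apply: eq_bigr => i _; rewrite big_distrr.
  have e3 : (\sum_i f i ^+ 2) * (\sum_i g i ^+ 2) = \sum_i \sum_j f j ^+ 2 * g i ^+ 2.
    by rewrite e1 exchange_big.
  rewrite mulrDl mul1r {1}e1 {1}e3 e2 mulr_sumr -sumrN -!big_split /=.
  apply: eq_bigr => i _; rewrite mulr_sumr -sumrN -!big_split /=.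
  by apply: eq_bigr => j _; ring.
lra.
Qed.

Lemma edist_ge0 x y : 0 <= edist x y. Proof. exact: sqrtr_ge0. Qed.

Lemma edist_sqr x y : edist x y ^+ 2 = \sum_(i < m) (x ord0 i - y ord0 i) ^+ 2.
Proof. by rewrite sqr_sqrtr// sumr_ge0// => i _; exact: sqr_ge0. Qed.

Lemma edistxx x : edist x x = 0.
Proof.
apply/eqP; rewrite -sqrf_eq0 edist_sqr big1// => i _.
by rewrite subrr expr0n.
Qed.

Lemma edistC x y : edist x y = edist y x.
Proof. by congr Num.sqrt; apply: eq_bigr => i _; rewrite -sqrrN opprB. Qed.

Lemma edist_triangle y x z : edist x z <= edist x y + edist y z.
Proof.
rewrite -(@ler_pXn2r _ 2)// ?nnegrE ?addr_ge0 ?edist_ge0//.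
have cs := cauchy_schwarz (fun i => x ord0 i - y ord0 i) (fun i => y ord0 i - z ord0 i).
have : \sum_i (x ord0 i - y ord0 i) * (y ord0 i - z ord0 i) <= edist x y * edist y z.
  apply: le_trans (ler_norm _) _; rewrite -(@ler_pXn2r _ 2)// ?nnegrE ?mulr_ge0 ?edist_ge0//.
  by rewrite exprMn !edist_sqr real_normK ?num_real.
rewrite sqrrD !edist_sqr => h.
rewrite (eq_bigr (fun i => (x ord0 i - y ord0 i) ^+ 2 + (y ord0 i - z ord0 i) ^+ 2 +
   2 * ((x ord0 i - y ord0 i) * (y ord0 i - z ord0 i)))); last by move=> i _; ring.
rewrite !big_split /= -mulr_sumr -mulr_natl; lra.
Qed.

Lemma coord_le_edist x y i : `|x ord0 i - y ord0 i| <= edist x y.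
Proof.
rewrite -(@ler_pXn2r _ 2)// ?nnegrE ?edist_ge0// edist_sqr real_normK ?num_real//.
by rewrite (bigD1 i)//= lerDl sumr_ge0// => j _; exact: sqr_ge0.
Qed.

Lemma edist_le_sum x y : edist x y <= \sum_(i < m) `|x ord0 i - y ord0 i|.
Proof.
rewrite -(@ler_pXn2r _ 2)// ?nnegrE ?edist_ge0 ?sumr_ge0// edist_sqr expr2 big_distrl /=.
apply: ler_sum => i _; rewrite -real_normK ?num_real// expr2 ler_wpM2l//.
by rewrite (bigD1 i)//= lerDl sumr_ge0.
Qed.

Lemma lip1_edist a : lip1 (edist ^~ a).
Proof.
move=> x y; rewrite ler_norml; apply/andP; split.
  by have := edist_triangle x y a; rewrite (edistC y x); lra.
by have := edist_triangle y x a; lra.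
Qed.

Lemma lip1_continuous (h : 'rV[R]_m -> R) : lip1 h -> continuous h.
Proof.
move=> lh x; have FF := @nbhs_filter _ x; apply/(@cvgrPdist_lt _ _ _ _ FF) => e e0.
(* Balls of row vectors refer to the maximum norm, which costs a factor [m]; [m.+1] also avoids
   division by 0. *)
pose d := e / m.+1%:R; have d0 : 0 < d by rewrite divr_gt0.
apply/nbhs_ballP; exists d => //= y [_ xy].
apply: le_lt_trans (lh x y) _; apply: le_lt_trans (edist_le_sum x y) _.
apply: (@le_lt_trans _ _ (\sum_(i < m) d)).
  by apply: ler_sum => i _; apply: ltW; exact: xy.
rewrite sumr_const card_ord -mulr_natl /d mulrA ltr_pdivrMr// mulrC ltr_pM2l//.
by rewrite ltr_nat.
Qed.

Lemma measurable_open_Rm (U : set 'rV[R]_m) : open U -> measurable (U : set (Rm R m)).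
Proof. by move=> oU; apply: sub_sigma_algebra. Qed.

Lemma continuous_measurable_Rm (h : 'rV[R]_m -> R) : continuous h ->
  measurable_fun setT (h : Rm R m -> R).
Proof.
move=> /continuousP ch; apply: (measurability _ (RGenOpens.measurableE R)).
move=> _ [_ [a [b ->] <-]]; rewrite setTI; apply: measurable_open_Rm.
exact/ch/interval_open.
Qed.

Lemma measurable_edist a : measurable_fun setT (edist ^~ a : Rm R m -> R).
Proof. exact: (continuous_measurable_Rm (lip1_continuous (lip1_edist a))). Qed.

Lemma measurable_cball a (r : R) : measurable ([set y | edist y a <= r] : set (Rm R m)).
Proof.
have := measurable_edist a measurableT (measurable_itv `]-oo, r]); rewrite setTI.
by congr measurable; apply/seteqP; split => y /=; rewrite in_itv.
Qed.

(** The head is both start value and member of the minimum; dropping one copy allows induction on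
    the tail. *)
Lemma dA_cons x a A : dA x (a :: A) = \big[Num.min/edist x a]_(b <- A) edist x b.
Proof.
rewrite /dA /= big_cons; elim: A => [|b A IH]; first by rewrite big_nil minxx.
by rewrite !big_cons minCA IH.
Qed.

Lemma dA_le x A a : a \in A -> dA x A <= edist x a.
Proof.
case: A => // b A; rewrite dA_cons inE => aA.
elim: A aA => [|c A IH]; first by rewrite orbF big_nil => /eqP ->.
rewrite inE big_cons ge_min => /or3P[/eqP ab|/eqP ->|aA]; rewrite ?lexx// ?orbT//.
  by rewrite IH ?ab ?eqxx ?orbT.
by rewrite IH ?aA ?orbT.
Qed.

Lemma dA_lt x A (r : R) : (0 < size A)%N -> dA x A < r -> exists2 a, a \in A & edist x a < r.
Proof.
case: A => // b A _; rewrite dA_cons.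
elim: A => [|c A IH]; first by rewrite big_nil => h; exists b => //; rewrite inE.
rewrite big_cons gt_min => /orP[h|/IH[a]]; first by exists c => //; rewrite !inE eqxx orbT.
by rewrite inE => /predU1P[->|aA] h; [exists b|exists a] => //; rewrite !inE ?eqxx ?aA ?orbT.
Qed.

Lemma dA_ge0 x A : (0 < size A)%N -> 0 <= dA x A.
Proof.
move=> sA; rewrite leNgt; apply/negP => /(dA_lt sA)[a _].
by rewrite ltNge edist_ge0.
Qed.

Lemma measurable_dA A : (0 < size A)%N ->
  measurable_fun setT ((fun x => dA x A) : Rm R m -> R).
Proof.
case: A => // b A _; under eq_fun do rewrite dA_cons.
elim: A => [|c A IH]; first by under eq_fun do rewrite big_nil; exact: measurable_edist.
under eq_fun do rewrite big_cons.
by apply: measurable_minr => //; exact: measurable_edist.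
Qed.

Lemma measurable_neglog : measurable_fun setT (@neglog R : R -> \bar R).
Proof.
apply: measurable_maxe => //; apply: measurableT_comp => //.
apply: measurable_fun_ifT => //=.
- exact: measurable_fun_eqr.
- by apply/measurable_EFinP; exact: measurable_ln.
Qed.

Lemma measurable_elog : measurable_fun setT (fun r : R => elog r%:E).
Proof.
apply: measurable_fun_ifT => //=.
- exact: measurable_fun_eqr.
- by apply/measurable_EFinP; exact: measurable_ln.
Qed.

Lemma hterm_cball (s : R) a (r : R) : 0 <= s -> 0 <= r ->
  hterm s [set y | edist y a <= r] <= (2 * r) `^ s.
Proof.
move=> s0 r0; rewrite /hterm; case: asboolP => [_|/eqP/set0P[y ya]]; first exact: powR_ge0.
have ub : ubound [set edist p.1 p.2 | p in [set y | edist y a <= r] `*` [set y | edist y a <= r]] (2 * r).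
  move=> _ [[p q] [/= pa qa] <-] /=.
  by have := edist_triangle a p q; rewrite (edistC a q); lra.
have ne : [set edist p.1 p.2 | p in [set y | edist y a <= r] `*` [set y | edist y a <= r]] !=set0.
  by exists (edist y y), (y, y).
apply: ge0_ler_powR => //; rewrite ?nnegrE ?mulr_ge0//.
  rewrite -(edistxx y); apply: ub_le_sup; first by exists (2 * r).
  by exists (y, y).
exact: ge_sup.
Qed.

Lemma hterm_ge0 (s : R) (U : set 'rV[R]_m) : 0 <= hterm s U.
Proof. by rewrite /hterm; case: asboolP => // _; exact: powR_ge0. Qed.

(** A finite list of balls becomes a countable cover when padded with empty sets, whose [hterm] is
    0. *)
Lemma Hmeas_eq0 (s : R) (E : set 'rV[R]_m) : 0 <= s ->
  (forall e : R, 0 < e -> exists L : seq ('rV[R]_m * R),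
    [/\ forall p, p \in L -> 0 <= p.2 <= e,
        forall x, E x -> exists2 p, p \in L & edist x p.1 <= p.2 &
        \sum_(p <- L) (2 * p.2) `^ s <= e]) ->
  Hmeas s E = 0%E.
Proof.
move=> s0 cov.
have H0 d : 0 < d -> Hdelta s d E = 0%E.
  move=> d0; apply/eqP; rewrite eq_le; apply/andP; split; last first.
    apply/ereal_infP => _ [U _ <-].
    by apply: nneseries_ge0 => i _ _; rewrite lee_fin hterm_ge0.
  apply/lee_addgt0Pr => e e0; rewrite add0e.
  (* Radii up to [d / 2] give diameters up to [d]. *)
  have [L [Lr LE Ls]] := cov (Num.min e (d / 2)) ltac:(by rewrite lt_min e0 divr_gt0).
  pose nt i := nth (0, 0) L i.
  pose U i := if (i < size L)%N then [set y | edist y (nt i).1 <= (nt i).2] else set0.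
  have rL i : (i < size L)%N -> 0 <= (nt i).2 <= d / 2.
    by move=> /(mem_nth (0, 0))/Lr; rewrite le_min; lra.
  apply: (@le_trans _ _ (\sum_(0 <= i <oo) (hterm s (U i))%:E)%E).
    apply: ereal_inf_lbound; exists U => //; split.
      move=> x /LE[p pL xp]; exists (index p L) => //.
      by rewrite /U index_mem pL /= /nt nth_index.
    move=> i x y; rewrite /U; case: ifP => // /rL hr /= xa ya.
    by have := edist_triangle (nt i).1 x y; rewrite (edistC (nt i).1 y); lra.
  apply: lime_le; first by apply: is_cvg_nneseries => i _ _; rewrite lee_fin hterm_ge0.
  exists (size L) => // K /= LK.
  rewrite (big_cat_nat (leq0n _) LK)/= [X in (_ + X)%E]big1_seq; last first.
    move=> i; rewrite mem_index_iota => /andP[_ /andP[Li _]].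
    by rewrite /U ltnNge Li /= /hterm; case: asboolP.
  rewrite adde0.
  rewrite sumEFin lee_fin.
  apply: (@le_trans _ _ (\sum_(p <- L) (2 * p.2) `^ s)); last first.
    by apply: le_trans Ls _; rewrite ge_min lexx.
  rewrite (big_nth (0, 0)) !big_mkord; apply: ler_sum => i _; have iL := ltn_ord i.
  by rewrite /U iL; apply: hterm_cball => //; case/andP: (rL i iL).
apply/eqP; rewrite eq_le; apply/andP; split.
  by apply/ereal_supP => _ [d /= d0 <-]; rewrite H0.
by apply: ereal_sup_ubound; exists 1 => //=; rewrite H0.
Qed.

Lemma dimH_set_ge0 (E : set 'rV[R]_m) : (0 <= dimH_set E)%E.
Proof. by apply/ereal_infP => _ [s [s0 _] <-]; rewrite lee_fin. Qed.

Lemma dimH_le (mu : probability (Rm R m) R) (E : set (Rm R m)) (s : R) :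
  measurable E -> mu E = 1%E -> 0 <= s -> Hmeas s E = 0%E -> (dimH mu <= s%:E)%E.
Proof.
move=> mE E1 s0 HE; apply: (@le_trans _ _ (dimH_set E)).
  by apply: ereal_inf_lbound; exists E.
by apply: ereal_inf_lbound; exists s.
Qed.

Lemma dimH_ge0 (mu : probability (Rm R m) R) : (0 <= dimH mu)%E.
Proof. by apply/ereal_infP => _ [E _ <-]; exact: dimH_set_ge0. Qed.

End Euclidean.

(** * Laws, couplings and quantization errors *)

Lemma integral_cst_prob (R : realType) (d : measure_display) (T : measurableType d)
  (P : probability T R) (c : \bar R) : (\int[P]_w c = c)%E.
Proof.
by rewrite integral_cst// (_ : (P : measure T R) [set: T] = 1%E) ?mule1//; exact: probability_setT.
Qed.

Section ImageLaw.
Context {R : realType} {d d' : measure_display} {T : measurableType d} {T' : measurableType d'}.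
Variables (P : probability T R) (Y : T -> T').
Hypothesis mY : measurable_fun setT Y.

Definition has_law (nu : probability T' R) := forall A, measurable A -> nu A = P (Y @^-1` A).

Lemma has_law_exists : exists nu : probability T' R, has_law nu.
Proof.
pose X : {mfun T >-> T'} := HB.pack_for {mfun T >-> T'} Y (isMeasurableFun.Build _ _ _ _ _ mY).
by exists (distribution P X).
Qed.

Variable nu : probability T' R.
Hypothesis nuY : has_law nu.

Let X : {mfun T >-> T'} := HB.pack_for {mfun T >-> T'} Y (isMeasurableFun.Build _ _ _ _ _ mY).

Lemma ge0_integral_law (f : T' -> \bar R) : measurable_fun setT f -> (forall y, (0 <= f y)%E) ->
  (\int[nu]_y f y = \int[P]_w f (Y w))%E.
Proof.
move=> mf f0; rewrite (eq_measure_integral (distribution P X)); last by move=> A mA _; exact: nuY.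
by rewrite ge0_integral_distribution.
Qed.

Lemma integral_law (f : T' -> \bar R) : measurable_fun setT f -> P.-integrable setT (f \o Y) ->
  (\int[nu]_y f y = \int[P]_w f (Y w))%E.
Proof.
move=> mf fi; rewrite (eq_measure_integral (distribution P X)); last by move=> A mA _; exact: nuY.
by rewrite integral_distribution.
Qed.

End ImageLaw.

Section Coupling.
Context {R : realType} {m : nat} {d : measure_display} {T : measurableType d}.
Variables (P : probability T R) (X Y : T -> Rm R m) (mu nu : probability (Rm R m) R).
Hypotheses (mX : measurable_fun setT X) (mY : measurable_fun setT Y).
Hypotheses (muX : has_law P X mu) (nuY : has_law P Y nu).

Lemma measurable_lip1 (h : 'rV[R]_m -> R) : lip1 h ->
  measurable_fun setT (fun y : Rm R m => (h y)%:E).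
Proof.
by move=> lh; apply/measurable_EFinP; exact: (continuous_measurable_Rm (lip1_continuous lh)).
Qed.

Lemma lip1_integrable (Z : T -> Rm R m) (nuZ : probability (Rm R m) R) (h : 'rV[R]_m -> R) :
  measurable_fun setT Z -> has_law P Z nuZ -> in_Omega nuZ -> lip1 h ->
  P.-integrable setT (fun w => (h (Z w))%:E).
Proof.
move=> mZ nuZP iZ lh; have mhZ : measurable_fun setT (fun w => (h (Z w))%:E).
  exact: (measurableT_comp (measurable_lip1 lh) mZ).
apply/integrableP; split=> //.
apply: (@le_lt_trans _ _ (\int[P]_w ((edist (Z w) 0)%:E + (`|h 0|)%:E))%E).
  apply: ge0_le_integral => //.
  - exact: measurableT_comp.
  - apply: emeasurable_funD => //.
    exact: (measurableT_comp (measurable_lip1 (lip1_edist 0)) mZ).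
  - move=> w _; rewrite abse_EFin -EFinD lee_fin -lerBlDr.
    by apply: le_trans (lh _ _); rewrite lerBlDr -{1}(subrK (h 0) (h _)) ler_normD.
rewrite ge0_integralD//; last 2 first.
- by move=> w _; rewrite lee_fin edist_ge0.
- exact: (measurableT_comp (measurable_lip1 (lip1_edist 0)) mZ).
rewrite integral_cst_prob.
have -> : (\int[P]_w (edist (Z w) 0)%:E = \int[nuZ]_y (edist y 0)%:E)%E.
  by rewrite (ge0_integral_law mZ nuZP)// => [|y]; [exact: measurable_lip1 (lip1_edist 0)|rewrite lee_fin edist_ge0].
by rewrite lte_add_pinfty// ltry.
Qed.

(** The easy half of Kantorovich duality: between [X w] and [Y w] a 1-Lipschitz [h] varies by at
    most their distance. *)
Lemma dL_coupling (D : T -> \bar R) : in_Omega mu -> in_Omega nu ->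
  measurable_fun setT D -> (forall w, ((edist (X w) (Y w))%:E <= D w)%E) ->
  (dL mu nu <= \int[P]_w D w)%E.
Proof.
move=> imu inu mD XYD; apply/ereal_supP => _ [h lh <-].
have iX := lip1_integrable mX muX imu lh; have iY := lip1_integrable mY nuY inu lh.
rewrite (integral_law mX muX)//; last exact: measurable_lip1.
rewrite (integral_law mY nuY)//; last exact: measurable_lip1.
have mB : measurable_fun setT (fun w => (h (X w))%:E - (h (Y w))%:E)%E.
  by apply: emeasurable_funB; [case/integrableP: iX|case/integrableP: iY].
rewrite -integralB_EFin//; apply: le_trans (le_abse_integral _ _ _) _ => //.
apply: ge0_le_integral => //; first exact: measurableT_comp.
by move=> w _; apply: le_trans (XYD w); rewrite -EFinB abse_EFin lee_fin lh.
Qed.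

End Coupling.

(** * Quantization errors from bounds on the mean negative logarithm *)

Section QuantizationBounds.
Context {R : realType} {m : nat}.
Variables (nu : probability (Rm R m) R) (n : nat) (B : R).
Hypothesis codeB : forall A, codebooks n A -> (\int[nu]_y neglog (dA y A) <= B%:E)%E.

Let mnl A : (0 < size A)%N -> measurable_fun setT (fun y : Rm R m => neglog (dA y A)).
Proof. by move=> sA; exact: (measurableT_comp measurable_neglog (measurable_dA sA)). Qed.

Lemma measurable_dA_powR (A : seq 'rV[R]_m) (r : R) : (0 < size A)%N ->
  measurable_fun setT (fun y : Rm R m => ((dA y A) `^ r)%:E).
Proof.
move=> sA; apply/measurable_EFinP.
exact: (measurableT_comp (measurable_powR r) (measurable_dA sA)).
Qed.

(** Jensen's inequality: on integrating [powR_tangent] the two terms in [r * B] cancel. *)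
Lemma Vq_ge (r : R) : 0 < r -> ((expR (- (r * B)))%:E <= Vq nu n r)%E.
Proof.
move=> r0; apply/ereal_infP => _ [A cA <-].
have sA : (0 < size A)%N by case/andP: cA.
have E0 := expR_gt0 (- (r * B)).
have B0 : 0 <= B.
  by rewrite -lee_fin; apply: le_trans (codeB cA); apply: integral_ge0 => y _; exact: neglog_ge0.
have h : ((expR (- (r * B)) * (1 + r * B))%:E <=
    \int[nu]_y ((dA y A) `^ r)%:E + (expR (- (r * B)) * r)%:E * \int[nu]_y neglog (dA y A))%E.
  rewrite -ge0_integralZl//; last 3 first.
  - exact: mnl.
  - by move=> y _; exact: neglog_ge0.
  - by rewrite lee_fin mulr_ge0// ltW.
  rewrite -ge0_integralD//; last 4 first.
  - by move=> y _; rewrite lee_fin powR_ge0.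
  - exact: measurable_dA_powR.
  - by move=> y _; rewrite mule_ge0 ?neglog_ge0// lee_fin mulr_ge0// ltW.
  - by apply: emeasurable_funM => //; exact: mnl.
  apply: (@le_trans _ _ (\int[nu]_y ((expR (- (r * B)) * (1 + r * B))%:E))%E).
    by rewrite integral_cst_prob.
  apply: ge0_le_integral => //.
  - by move=> y _; rewrite lee_fin mulr_ge0 ?(ltW E0)// addr_ge0// mulr_ge0// ltW.
  - by apply: emeasurable_funD; [exact: measurable_dA_powR|apply: emeasurable_funM => //; exact: mnl].
  - by move=> y _; apply: powR_tangent => //; exact: dA_ge0.
have {}h : ((expR (- (r * B)) * (1 + r * B))%:E <=
    \int[nu]_y ((dA y A) `^ r)%:E + (expR (- (r * B)) * r * B)%:E)%E.
  apply: le_trans h _; rewrite leeD2l// (EFinM (_ * r) B) lee_pmul2l ?lte_fin ?mulr_gt0//.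
  exact: codeB.
have : ((expR (- (r * B)) * (1 + r * B))%:E - (expR (- (r * B)) * r * B)%:E <=
    \int[nu]_y ((dA y A) `^ r)%:E)%E by rewrite leeBlDr.
by apply: le_trans; rewrite -EFinB lee_fin; lra.
Qed.

Lemma logen_ge : ((- B)%:E <= logen nu n)%E.
Proof.
apply/ereal_infP => _ [A cA <-]; rewrite integralE.
have p0 : (0 <= \int[nu]_y ((fun y => elog (dA y A)%:E) ^\+ y))%E.
  by apply: integral_ge0 => y _; exact: funepos_ge0.
have n0 : (\int[nu]_y ((fun y => elog (dA y A)%:E) ^\- y) <= B%:E)%E.
  apply: le_trans (codeB cA); rewrite le_eqVlt; apply/orP; left; apply/eqP.
  by apply: eq_integral => y _; rewrite funenegE.
by have := leeB p0 n0; rewrite sub0e.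
Qed.

Context {d : measure_display} {T : measurableType d} (P : probability T R) (Y : T -> Rm R m).
Hypotheses (mY : measurable_fun setT Y) (nuY : has_law P Y nu).
Variables (A0 : seq 'rV[R]_m) (rho : R).
Hypotheses (cA0 : codebooks n A0) (rho01 : 0 < rho <= 1) (A0rho : forall w, dA (Y w) A0 <= rho).

Let sA0 : (0 < size A0)%N. Proof. by case/andP: cA0. Qed.

Lemma Vq_le (r : R) : 0 < r -> (Vq nu n r <= (rho `^ r)%:E)%E.
Proof.
move=> r0; apply: (@le_trans _ _ (\int[nu]_y ((dA y A0) `^ r)%:E)%E).
  by apply: ereal_inf_lbound; exists A0.
rewrite (ge0_integral_law mY nuY); [|exact: measurable_dA_powR|by move=> y; rewrite lee_fin powR_ge0].
rewrite -[leRHS](integral_cst_prob P); apply: ge0_le_integral => //.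
- by move=> w _; rewrite lee_fin powR_ge0.
- exact: (measurableT_comp (measurable_dA_powR r sA0) mY).
- move=> w _; rewrite lee_fin; apply: ge0_ler_powR => //; rewrite ?nnegrE ?dA_ge0 ?(ltW r0)//.
  by case/andP: rho01 => /ltW.
Qed.

Lemma logen_le : (logen nu n <= (ln rho)%:E)%E.
Proof.
apply: (@le_trans _ _ (\int[nu]_y elog (dA y A0)%:E)%E).
  by apply: ereal_inf_lbound; exists A0.
have melog : measurable_fun setT (fun y : Rm R m => elog (dA y A0)%:E).
  exact: (measurableT_comp measurable_elog (measurable_dA sA0)).
have [r0 r1] := andP rho01.
have el w : (elog (dA (Y w) A0)%:E <= (ln rho)%:E)%E.
  rewrite /elog; case: eqP => [_|/eqP d0]; first by rewrite leNye.
  have d1 : 0 < dA (Y w) A0 by rewrite lt_neqAle eq_sym d0 dA_ge0.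
  by rewrite lee_fin ler_ln.
(* The integrand may be [-oo], so its parts are integrated separately; as [rho <= 1], the positive
   part vanishes. *)
rewrite integralE.
rewrite (ge0_integral_law mY nuY); [|exact: measurable_funepos|by move=> y; exact: funepos_ge0].
rewrite (ge0_integral_law mY nuY); [|exact: measurable_funeneg|by move=> y; exact: funeneg_ge0].
rewrite (eq_integral (cst 0%E)); last first.
  move=> w _; rewrite funeposE; apply/max_idPr.
  by apply: le_trans (el w) _; rewrite lee_fin ln_le0.
rewrite integral_cst_prob sub0e leeNl -EFinN.
rewrite -[leLHS](integral_cst_prob P); apply: ge0_le_integral => //.
- by move=> w _; rewrite lee_fin oppr_ge0 ln_le0.
- exact: (measurableT_comp (measurable_funeneg melog) mY).
- by move=> w _; rewrite funenegE le_max EFinN leeN2 el.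
Qed.

End QuantizationBounds.

(** A squeeze: minus the logarithm of the error is at most [(1 + e) ln n] by the first bound, and at
    least [ln n - ln C] by the codebook of radius [C / n]. *)
Lemma quantization_dimension1 (R : realType) (m : nat) (nu : probability (Rm R m) R)
    (d : measure_display) (T : measurableType d) (P : probability T R) (Y : T -> Rm R m) (C : R) :
  measurable_fun setT Y -> has_law P Y nu -> 0 < C ->
  (forall e : R, 0 < e -> \forall n \near \oo, exists2 B, B <= (1 + e) * ln n%:R &
     forall A, codebooks n A -> (\int[nu]_y neglog (dA y A) <= B%:E)%E) ->
  (\forall n \near \oo, exists2 A, codebooks n A & forall w, dA (Y w) A <= C / n%:R) ->
  (forall r, 0 < r -> has_Dr nu r 1) /\ has_D0 nu 1.
Proof.
move=> mY nuY C0 H1 H2.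
have H3 (e : R) : 0 < e -> \forall n \near \oo, (1 - e) * ln n%:R <= - ln (C / n%:R) /\
    0 < C / n%:R <= 1.
  move=> e0; have [N hN] : exists N : nat, expR (ln C / e) + C <= N%:R.
    by exists (Num.truncn (expR (ln C / e) + C)).+1; apply: ltW; rewrite truncnS_gt.
  exists N.+1 => // n /= Nn; have n0 : 0 < n%:R :> R by rewrite ltr0n; lia.
  have {}hN : expR (ln C / e) + C <= n%:R.
    by apply: le_trans hN _; rewrite ler_nat ltnW.
  have lnn : ln C / e <= ln n%:R.
    rewrite -[leLHS]expRK ler_ln ?posrE ?expR_gt0//; lra.
  split; last by rewrite divr_gt0//= ler_pdivrMr// mul1r; have := expR_gt0 (ln C / e); lra.
  rewrite ln_div ?posrE//; move: lnn; rewrite ler_pdivrMr//; lra.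
(* Common to both dimensions: [F n] is -log V_{n,r}, or -log e_n with [r = 1]. *)
have cvg_aux (F : nat -> \bar R) (r : R) : 0 < r ->
    (forall n B rho, (forall A, codebooks n A -> (\int[nu]_y neglog (dA y A) <= B%:E)%E) ->
       (exists2 A, codebooks n A & forall w, dA (Y w) A <= rho) -> 0 < rho <= 1 ->
       ((r * - ln rho)%:E <= F n <= (r * B)%:E)%E) ->
    ((r * ln n%:R)%:E * (F n)^-1)%E @[n --> \oo] --> (1 : R)%:E.
  move=> r0 HF; apply: ratio_cvg => // e e0.
  near=> n.
  have [B Be HB] : exists2 B, B <= (1 + e) * ln n%:R &
     forall A, codebooks n A -> (\int[nu]_y neglog (dA y A) <= B%:E)%E by near: n; exact: H1.
  have [lr rho01] : (1 - e) * ln n%:R <= - ln (C / n%:R) /\ 0 < C / n%:R <= 1 by near: n; exact: H3.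
  have hA : exists2 A, codebooks n A & forall w, dA (Y w) A <= C / n%:R by near: n.
  have /andP[h1 h2] := HF n B _ HB hA rho01.
  apply/andP; split.
    by apply: le_trans h1; rewrite lee_fin ler_pM2l.
  by apply: le_trans h2 _; rewrite lee_fin ler_pM2l.
split=> [r r0|].
  apply: cvg_aux => // n B rho HB [A cA hA] rho01.
  have h1 := Vq_ge HB r0; have h2 := Vq_le mY nuY cA rho01 hA r0.
  have [q0 q1] := andP rho01.
  move: h1 h2; case: (Vq nu n r) => [v| |]; rewrite ?lee_fin// => h1 h2.
  have v0 : 0 < v by apply: lt_le_trans h1; exact: expR_gt0.
  rewrite /elog gt_eqF// -EFinN !lee_fin mulrN lerN2 -ln_powR ler_ln ?posrE ?powR_gt0// h2 /=.
  by rewrite lerNl -[leLHS]expRK ler_ln ?posrE ?expR_gt0.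
have := cvg_aux (fun n => - logen nu n)%E 1 ltr01.
rewrite /has_D0 /qratio0; under eq_fun do rewrite mul1r; apply.
move=> n B rho HB [A cA hA] rho01; rewrite !mul1r.
apply/andP; split.
  by rewrite EFinN leeN2; exact: (logen_le mY nuY cA rho01 hA).
by rewrite leeNl -EFinN; exact: (logen_ge HB).
Unshelve. all: by end_near. Qed.

(** * Finite-valued approximation of the identity *)

Section SimpleApproximation.
Context {R : realType} {m : nat}.
Implicit Types (x : 'rV[R]_m) (z : R).

(** Rounding down to a multiple of 1 / (k + 1), and 0 for large [z]; the indicator form gives
    measurability. *)
Definition cut (k : nat) z : R :=
  \1_[set y : R | `|y| <= k.+1%:R] z * ((Num.floor (k.+1%:R * z))%:~R / k.+1%:R).

Lemma cutE k z : cut k z =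
  if `|z| <= k.+1%:R then (Num.floor (k.+1%:R * z))%:~R / k.+1%:R else 0.
Proof.
rewrite /cut indicE; case: ifPn => zk; first by rewrite mem_set// mul1r.
by rewrite memNset ?mul0r//; exact/negP.
Qed.

Lemma measurable_cut k : measurable_fun setT (cut k).
Proof.
apply: measurable_funM.
  apply: measurable_indic.
  rewrite (_ : [set y : R | _] = `[- k.+1%:R, k.+1%:R]%classic)//.
  by apply/seteqP; split => y /=; rewrite in_itv /= ler_norml.
apply: nondecreasing_measurable => // y z yz.
by rewrite ler_pM2r ?invr_gt0// ler_int le_floor// ler_pM2l.
Qed.

Lemma cut_close k z : `|z| <= k.+1%:R -> `|z - cut k z| <= k.+1%:R^-1.
Proof.
move=> zk; rewrite cutE zk; have k0 : 0 < k.+1%:R :> R by [].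
have := floor_itv (k.+1%:R * z); rewrite intrD => /andP[h1 h2].
have e : z - (Num.floor (k.+1%:R * z))%:~R / k.+1%:R =
    (k.+1%:R * z - (Num.floor (k.+1%:R * z))%:~R) / k.+1%:R.
  by field; rewrite gt_eqF.
rewrite e normrM normfV (gtr0_norm k0) ler_pdivrMr// mulVf ?gt_eqF//.
rewrite ger0_norm ?subr_ge0//; lra.
Qed.

Lemma cut_dominated k z : `|z - cut k z| <= `|z| + 1.
Proof.
have [zk|zk] := leP `|z| k.+1%:R.
  apply: le_trans (cut_close zk) _; rewrite -[leLHS]add0r lerD//.
  by rewrite invf_le1// ler1n.
by rewrite cutE (lt_geF zk) subr0 lerDl.
Qed.

Definition cut_mx k x : 'rV[R]_m := \row_i cut k (x ord0 i).

(** Numerators of rounded values lie between -(k + 1)^2 and (k + 1)^2, whence the shift. *)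
Definition cut_range k : seq 'rV[R]_m :=
  [seq \row_i (((f i : nat)%:R - (k.+1 ^ 2)%N%:R) / k.+1%:R)
  | f : {ffun 'I_m -> 'I_(2 * k.+1 ^ 2).+1}].

Lemma cut_mx_range k x : cut_mx k x \in cut_range k.
Proof.
pose M := (k.+1 ^ 2)%N; have k0 : 0 < k.+1%:R :> R by [].
have ex i : exists j : 'I_(2 * M).+1, cut k (x ord0 i) = ((j : nat)%:R - M%:R) / k.+1%:R.
  rewrite cutE; case: ifPn => [xk|_]; last first.
    have h : (M < (2 * M).+1)%N by lia.
    by exists (Ordinal h); rewrite subrr mul0r.
  set F := Num.floor _; have := floor_itv (k.+1%:R * x ord0 i); rewrite -/F => /andP[h1 h2].
  have MR : M%:R = k.+1%:R * k.+1%:R :> R by rewrite natrX expr2.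
  move: xk; rewrite ler_norml => /andP[xk1 xk2].
  have b1 : - M%:Z <= F by rewrite floor_ge_int intrN -pmulrn MR -mulrN ler_pM2l.
  have b2 : F <= M%:Z.
    by rewrite -(ler_int R); apply: le_trans h1 _; rewrite -pmulrn MR ler_pM2l.
  have FM : 0 <= F + M%:Z by lia.
  have h : (absz (F + M%:Z)%R < (2 * M).+1)%N by lia.
  exists (Ordinal h); congr (_ / _) => /=.
  by rewrite [X in _ = X - _]pmulrn gez0_abs// intrD -pmulrn addrK.
have [f fE] := choice ex; apply/mapP; exists [ffun i => f i]; first by rewrite mem_enum.
by apply/rowP => i; rewrite !mxE fE ffunE.
Qed.

(** The l^1 error, which dominates the Euclidean one. *)
Definition cut_err k x : R := \sum_(i < m) `|x ord0 i - cut k (x ord0 i)|.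

Lemma measurable_coord i : measurable_fun setT (fun x : Rm R m => (x : 'rV[R]_m) ord0 i).
Proof. by apply: continuous_measurable_Rm; exact: coord_continuous. Qed.

Lemma measurable_cut_err k : measurable_fun setT (cut_err k : Rm R m -> R).
Proof.
apply: measurable_sum => i; apply: measurableT_comp => //.
apply: measurable_funB; first exact: measurable_coord.
exact: (measurableT_comp (measurable_cut k) (measurable_coord i)).
Qed.

Lemma measurable_cut_mx_fiber k (v : 'rV[R]_m) : measurable ([set x | cut_mx k x = v] : set (Rm R m)).
Proof.
pose G (x : Rm R m) := \sum_(i < m) `|cut k ((x : 'rV[R]_m) ord0 i) - v ord0 i|.
have mG : measurable_fun setT G.
  apply: measurable_sum => i; apply: measurableT_comp => //.
  apply: measurable_funB => //; exact: (measurableT_comp (measurable_cut k) (measurable_coord i)).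
have := mG measurableT _ (measurable_set1 0); rewrite setTI.
congr measurable; apply/seteqP; split => x /=; last first.
  by move=> xv; rewrite /G big1// => i _; rewrite -xv mxE subrr normr0.
move=> /psumr_eq0P h; apply/rowP => i; rewrite mxE; apply/eqP.
by rewrite -subr_eq0 -normr_eq0 h.
Qed.

Lemma edist_cut_mx k x : edist x (cut_mx k x) <= cut_err k x.
Proof.
apply: le_trans (edist_le_sum _ _) _; apply: ler_sum => i _.
by rewrite mxE.
Qed.

Lemma cut_err_cvg x : (cut_err k x)%:E @[k --> \oo] --> (0 : \bar R)%E.
Proof.
apply: cvg_EFin; first by near=> k.
apply/cvgrPdist_le => e e0.
have [N hN] : exists N : nat, edist x 0 + m%:R / e <= N%:R.
  by exists (Num.truncn (edist x 0 + m%:R / e)).+1; apply: ltW; rewrite truncnS_gt.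
exists N => // k /= Nk; rewrite sub0r normrN ger0_norm ?sumr_ge0//.
have hk : edist x 0 + m%:R / e <= k.+1%:R by apply: le_trans hN _; rewrite ler_nat ltnW.
have me0 : 0 <= m%:R / e by rewrite divr_ge0// ltW.
have xk i : `|x ord0 i| <= k.+1%:R.
  have := coord_le_edist x 0 i; rewrite mxE subr0 => h; lra.
apply: (@le_trans _ _ (\sum_(i < m) k.+1%:R^-1)).
  by apply: ler_sum => i _; exact: cut_close.
rewrite sumr_const card_ord -[leLHS]mulr_natl ler_pdivrMr// mulrC -ler_pdivrMr//.
have := edist_ge0 x 0; lra.
Unshelve. all: by end_near. Qed.

(** Dominated convergence; the finite first moment makes [g] integrable. *)
Lemma cut_approx (mu : probability (Rm R m) R) (e : R) : in_Omega mu -> 0 < e ->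
  exists k, (\int[mu]_x (cut_err k x)%:E < e%:E)%E.
Proof.
move=> imu e0.
pose g (x : Rm R m) : \bar R := (m%:R * (edist (x : 'rV[R]_m) 0 + 1))%:E.
have mg : measurable_fun setT g.
  apply/measurable_EFinP; apply: measurable_funM => //; apply: measurable_funD => //.
  exact: measurable_edist.
have ig : mu.-integrable setT g.
  have i1 : mu.-integrable setT (fun x => (edist (x : 'rV[R]_m) 0)%:E).
    apply/integrableP; split; first by apply/measurable_EFinP; exact: measurable_edist.
    by under eq_integral => x _ do rewrite abse_EFin ger0_norm ?edist_ge0//.
  have i2 : mu.-integrable setT (cst 1%E) by exact: (finite_measure_integrable_cst mu 1).
  rewrite (_ : g = fun x => (m%:R%:E * ((edist (x : 'rV[R]_m) 0)%:E + 1))%E); last first.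
    by apply/funext => x; rewrite /g EFinM EFinD.
  by apply: integrableZl => //; apply: integrableD.
have H := @dominated_cvg _ _ _ mu setT measurableT
  (fun k (x : Rm R m) => (cut_err k x)%:E) (cst 0%E) g.
rewrite integral_cst_prob in H.
have {}H : (\int[mu]_x (cut_err n x)%:E)%E @[n --> \oo] --> (0 : \bar R)%E.
  apply: H => //.
  - by move=> k; apply/measurable_EFinP; exact: measurable_cut_err.
  - by move=> x _; exact: cut_err_cvg.
  - move=> k x _; rewrite abse_EFin lee_fin ger0_norm ?sumr_ge0//.
    apply: (@le_trans _ _ (\sum_(i < m) (edist x 0 + 1))).
      apply: ler_sum => i _; apply: le_trans (cut_dominated _ _) _; rewrite lerD2r.
      by have := coord_le_edist x 0 i; rewrite mxE subr0.
    by rewrite sumr_const card_ord -[leLHS]mulr_natl.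
move/fine_cvgP: H => [Hfin /cvgrPdist_lt/(_ e e0) Hd].
have [k [hf hd]] := filter_ex (filterI Hfin Hd).
exists k; rewrite -(fineK hf) lte_fin; move: hd; rewrite /= sub0r normrN.
by apply: le_lt_trans; exact: ler_norm.
Qed.

End SimpleApproximation.

(** * The perturbed measures *)

Section Perturbation.
Context {R : realType} {m : nat}.
Implicit Types (v a : 'rV[R]_m.+1) (s : R).

Definition line v s : 'rV[R]_m.+1 := v + s *: delta_mx ord0 ord0.

Lemma line_coord0 v s : line v s ord0 ord0 = v ord0 ord0 + s.
Proof. by rewrite !mxE !eqxx mulr1. Qed.

Lemma line0 v : line v 0 = v. Proof. by rewrite /line scale0r addr0. Qed.

Lemma edist_line v s s' : edist (line v s) (line v s') <= `|s - s'|.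
Proof.
apply: le_trans (edist_le_sum _ _) _.
rewrite (bigD1 ord0)//= big1 => [|i /negbTE i0]; last first.
  by rewrite !mxE i0 andbF !mulr0 subrr normr0.
by rewrite !line_coord0 addr0 opprD addrACA subrr add0r.
Qed.

Lemma measurable_line v : measurable_fun setT (line v : R -> Rm R m.+1).
Proof.
apply: (@measurability _ _ (measurableTypeR R) (Rm R m.+1) setT (line v) (@open 'rV[R]_m.+1)) => // _ [B oB <-].
rewrite setTI.
apply: open_measurable; have : continuous (line v).
  by move=> s; apply: cvgD; [exact: cvg_cst|exact: scalel_continuous].
by move/continuousP; exact.
Qed.

Variables (mu : probability (Rm R m.+1) R) (k : nat) (delta : R).

Definition space := (Rm R m.+1 * measurableTypeR R)%type.

(** One space for both measures: [fst] has law [mu], and [perturb] has the approximating law. *)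
Definition coupling : probability space R := (mu \x unif)%E.

Definition perturb (w : space) : Rm R m.+1 := line (cut_mx k w.1) (delta * fcantor w.2).

(** [cut_mx k] takes finitely many values, so a preimage is a finite union of measurable
    rectangles. *)
Lemma measurable_perturb : measurable_fun setT perturb.
Proof.
move=> _ B mB; rewrite setTI.
rewrite (_ : perturb @^-1` B = \bigcup_(v in [set` cut_range k])
    ([set x | cut_mx k x = v] `*` [set t | B (line v (delta * fcantor t))])); last first.
  apply/seteqP; split => -[x t] /=.
    by move=> Bw; exists (cut_mx k x) => //; exact: cut_mx_range.
  by move=> [v _ [/= xv]]; rewrite /perturb /= xv.
rewrite bigcup_seq; apply: bigsetU_measurable => v _; apply: measurableX.
  exact: measurable_cut_mx_fiber.
have mf : measurable_fun setT (fun t : R => delta * fcantor t).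
  by apply: measurable_funM => //; exact: measurable_fcantor.
by have := measurableT_comp (measurable_line v) mf measurableT mB; rewrite setTI.
Qed.

Lemma fst_law : has_law coupling fst mu.
Proof.
move=> A mA; rewrite (_ : fst @^-1` A = A `*` setT); last first.
  by apply/seteqP; split => -[x t] //= [].
rewrite /coupling /= product_measure1E//.
by rewrite [X in (_ * X)%E](_ : _ = 1%E) ?mule1//; exact: (@probability_setT _ _ _ unif).
Qed.

Variable nu : probability (Rm R m.+1) R.
Hypothesis nuP : has_law coupling perturb nu.
Hypothesis delta01 : 0 <= delta <= 1.

Lemma fcantor_norm (t : R) : `|fcantor t| <= 1.
Proof. by have := fcantor_bounds t; rewrite ler_norml; lra. Qed.

Lemma perturb_close w : edist (cut_mx k w.1) (perturb w) <= delta.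
Proof.
rewrite -[X in edist X _]line0 edistC; apply: le_trans (edist_line _ _ _) _.
rewrite subr0 normrM; case/andP: delta01 => d0 _; rewrite (ger0_norm d0).
by rewrite -[leRHS]mulr1; apply: ler_wpM2l => //; exact: fcantor_norm.
Qed.

Lemma perturb_in_Omega : in_Omega nu.
Proof.
pose C := \sum_(v <- cut_range k) edist v (0 : 'rV[R]_m.+1) + delta.
have bnd w : edist (perturb w) 0 <= C.
  apply: le_trans (edist_triangle (cut_mx k w.1) _ _) _.
  rewrite addrC edistC [X in _ + X]edistC lerD ?perturb_close// edistC.
  rewrite (big_rem (cut_mx k w.1)) ?cut_mx_range//= lerDl sumr_ge0// => v _.
  exact: edist_ge0.
have me : measurable_fun setT (fun y : Rm R m.+1 => (edist (y : 'rV[R]_m.+1) 0)%:E).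
  by apply/measurable_EFinP; exact: measurable_edist.
rewrite /in_Omega (ge0_integral_law measurable_perturb nuP)//; last first.
  by move=> y; rewrite lee_fin edist_ge0.
apply: (@le_lt_trans _ _ C%:E); last exact: ltry.
rewrite -[leRHS](integral_cst_prob coupling); apply: ge0_le_integral => //.
- by move=> w _; rewrite lee_fin edist_ge0.
- exact: (measurableT_comp me measurable_perturb).
- by move=> w _; rewrite lee_fin bnd.
Qed.

(** Triangle inequality through [cut_mx k w.1]: rounding costs [e] in mean, the shift at most
    [delta]. *)
Lemma perturb_dL (e : R) : in_Omega mu -> (\int[mu]_x (cut_err k x)%:E < e%:E)%E ->
  (dL mu nu < (e + delta)%:E)%E.
Proof.
move=> imu he.
have mD : measurable_fun setT (fun w : space => (cut_err k w.1)%:E).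
  apply/measurable_EFinP.
  exact: (measurableT_comp (measurable_cut_err k) measurable_fst).
have := dL_coupling measurable_fst measurable_perturb fst_law nuP
   (D := fun w : space => ((cut_err k w.1)%:E + delta%:E)%E) imu perturb_in_Omega.
move=> /(_ _ _)/le_lt_trans; apply.
- exact: emeasurable_funD.
- move=> w; rewrite -EFinD lee_fin; apply: le_trans (edist_triangle (cut_mx k w.1) _ _) _.
  by rewrite lerD ?edist_cut_mx ?perturb_close.
have e0 x : (0 <= (cut_err k x)%:E :> \bar R)%E by rewrite lee_fin sumr_ge0.
case/andP: delta01 => d0 _.
rewrite ge0_integralD//.
rewrite integral_cst_prob EFinD lte_leD//.
rewrite -(ge0_integral_law measurable_fst fst_law (f := fun x => (cut_err k x)%:E))//.
by apply/measurable_EFinP; exact: measurable_cut_err.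
Qed.

End Perturbation.

(** * Finitely supported laws *)

Section FiniteSupport.
Context {R : realType} {m : nat} {d : measure_display} {T : measurableType d}.
Variables (P : probability T R) (Y : T -> Rm R m) (nu : probability (Rm R m) R) (A0 : seq 'rV[R]_m).
Hypotheses (mY : measurable_fun setT Y) (nuY : has_law P Y nu).
Hypotheses (sA0 : (0 < size A0)%N) (YA0 : forall w, Y w \in A0).

Let dA0 w : dA (Y w) A0 = 0.
Proof.
by apply/eqP; rewrite eq_le dA_ge0// andbT; have := dA_le (Y w) (YA0 w); rewrite edistxx.
Qed.

Lemma finite_support_Vq n (r : R) : (size A0 <= n)%N -> 0 < r -> Vq nu n r = 0%E.
Proof.
move=> An r0; apply/eqP; rewrite eq_le; apply/andP; split; last first.
  by apply/ereal_infP => _ [A _ <-]; apply: integral_ge0 => y _; rewrite lee_fin powR_ge0.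
apply: (@le_trans _ _ (\int[nu]_y ((dA y A0) `^ r)%:E)%E).
  by apply: ereal_inf_lbound; exists A0 => //; apply/andP.
rewrite (ge0_integral_law mY nuY); [|exact: measurable_dA_powR|by move=> y; rewrite lee_fin powR_ge0].
rewrite (eq_integral (cst 0%E)) ?integral_cst_prob// => w _.
by rewrite dA0 powR0// gt_eqF.
Qed.

Lemma finite_support_logen n : (size A0 <= n)%N -> logen nu n = -oo%E.
Proof.
move=> An; apply/eqP; rewrite -leeNy_eq.
apply: (@le_trans _ _ (\int[nu]_y elog (dA y A0)%:E)%E).
  by apply: ereal_inf_lbound; exists A0 => //; apply/andP.
have melog : measurable_fun setT (fun y : Rm R m => elog (dA y A0)%:E).
  exact: (measurableT_comp measurable_elog (measurable_dA sA0)).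
rewrite integralE.
rewrite (ge0_integral_law mY nuY); [|exact: measurable_funepos|by move=> y; exact: funepos_ge0].
rewrite (ge0_integral_law mY nuY); [|exact: measurable_funeneg|by move=> y; exact: funeneg_ge0].
rewrite (eq_integral (cst 0%E)); last first.
  by move=> w _; rewrite funeposE /elog dA0 eqxx; exact: maxNye.
rewrite [X in (_ - X)%E](eq_integral (cst +oo%E)); last first.
  by move=> w _; rewrite funenegE /elog dA0 eqxx /= maxye.
by rewrite !integral_cst_prob.
Qed.

(** Balls of radius 0 cover the support and contribute 0 for every exponent [s > 0]. *)
Lemma finite_support_dimH : dimH nu = 0%E.
Proof.
apply/eqP; rewrite eq_le dimH_ge0 andbT; apply/lee_addgt0Pr => s s0; rewrite add0e.
pose E : set (Rm R m) := \bigcup_(v in [set` A0]) [set y | edist y v <= 0].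
apply: (@dimH_le _ _ _ E) => //; last 2 first.
- exact: ltW.
- apply: Hmeas_eq0 => [|e e0]; first exact: ltW.
  exists [seq (v, 0) | v <- A0]; split.
  + by move=> p /mapP[v _ ->] /=; rewrite lexx ltW.
  + by move=> x [v /= vA xv]; exists (v, 0) => //; exact: map_f.
  + by rewrite big_map big1 ?ltW// => v _; rewrite mulr0 powR0// gt_eqF.
- by rewrite /E bigcup_seq; apply: bigsetU_measurable => v _; exact: measurable_cball.
- rewrite nuY.
    rewrite (_ : Y @^-1` E = setT) ?probability_setT//.
    by apply/seteqP; split => w // _; exists (Y w) => //=; rewrite edistxx.
  by rewrite /E bigcup_seq; apply: bigsetU_measurable => v _; exact: measurable_cball.
Qed.

(** Once [n] reaches [size A0] the errors vanish, their logarithms are [-oo], and the inverse of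
    [+oo] being 0 makes both ratios 0. *)
Lemma finite_support_Omega0 : in_Omega nu -> Omega0 nu.
Proof.
move=> iO; split=> //; exists 0; split; last split.
- exists 1; split=> //; exists (fun=> 0); split; last exact: cvg_cst.
  move=> r /andP[r0 _]; apply: cvg_near_cst; exists (size A0) => // n /= An.
  by rewrite /qratio finite_support_Vq// /elog /= eqxx /= mule0.
- apply: cvg_near_cst; exists (size A0) => // n /= An.
  by rewrite /qratio0 finite_support_logen// mule0.
- exact: finite_support_dimH.
Qed.

End FiniteSupport.

(** * Laws perturbed by the digit-erasing map *)

Section CantorPerturbation.
Context {R : realType} {m : nat}.
Variables (mu nu : probability (Rm R m.+1) R) (k : nat) (delta : R).
Hypotheses (nuP : has_law (coupling mu) (perturb k delta) nu) (delta01 : 0 < delta <= 1).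
Let rng := cut_range (R := R) (m := m.+1) k.

Let d0 : 0 < delta. Proof. by case/andP: delta01. Qed.

Let delta_le1 : delta <= 1. Proof. by case/andP: delta01. Qed.

Let rng_gt0 : (0 < size rng)%N.
Proof. by rewrite -has_predT; apply/hasP; exists (cut_mx k 0) => //; exact: cut_mx_range. Qed.

(** For fixed [v], projecting [A] to the first coordinate and rescaling by [delta] gives a codebook
    [As] for [fcantor]; the layer cake with [c = delta] reduces the claim to [hit_series_le]. *)
Lemma perturb_slice_le (v : 'rV[R]_m.+1) (A : seq 'rV[R]_m.+1) U J n :
  codebooks n A -> (n <= 2 ^ U)%N -> (win J <= 4 * U < win J.+1)%N ->
  (\int[unif]_t neglog (dA (line v (delta * fcantor t)) A) <=
   (ln 2 * ((U + lost J)%:R + dy (trunc_log 2 J.+1) * (U + lost J.+1)%:R + 25) + - ln delta)%:E)%E.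
Proof.
move=> /andP[sA An] nU UJ.
pose As := [seq (a ord0 ord0 - v ord0 ord0) / delta | a : 'rV[R]_m.+1 <- A].
have sAs : (size As <= 2 ^ U)%N by rewrite size_map; exact: leq_trans An nU.
have ln20 : 0 < ln 2 :> R := ln2_gt0.
have lnd : 0 <= - ln delta by rewrite oppr_ge0 ln_le0.
have pt t : (neglog (dA (line v (delta * fcantor t)) A) <=
    (- ln delta)%:E + (ln 2)%:E * \sum_(0 <= u <oo) (\1_(hit As u) t)%:E)%E.
  apply: le_trans (neglog_layer_cake delta01 (dA_ge0 _ sA)) _.
  rewrite leeD2l// lee_pmul2l ?lte_fin//; apply: lee_nneseries => [u _ _|u _].
    by rewrite lee_fin.
  rewrite lee_fin; case: ltP => // /(dA_lt sA)[a aA ya].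
  rewrite indicE mem_set// /hit /=; apply/hasP.
  exists ((a ord0 ord0 - v ord0 ord0) / delta); first exact: map_f.
  have := le_lt_trans (coord_le_edist _ _ ord0) ya; rewrite line_coord0 => h.
  rewrite -(ltr_pM2l d0); apply: le_lt_trans h.
  rewrite -{1}(gtr0_norm d0) -normrM le_eqVlt; apply/orP; left; apply/eqP; congr (`|_|).
  by field; rewrite gt_eqF.
have mf : measurable_fun setT (fun t : R => delta * fcantor t).
  by apply: measurable_funM => //; exact: measurable_fcantor.
have ms : measurable_fun setT
    (fun t : measurableTypeR R => (\sum_(0 <= u <oo) (\1_(hit As u) t)%:E : \bar R)%E).
  refine (@ge0_emeasurable_sum _ (measurableTypeR R) R setT
    (fun u t => (\1_(hit As u) t)%:E) xpredT _ _) => [u t _ _|u _].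
    by rewrite lee_fin.
  by apply/measurable_EFinP; apply: measurable_indic; exact: measurable_hit.
have s0 t : (0 <= \sum_(0 <= u <oo) (\1_(hit As u) t)%:E :> \bar R)%E.
  by apply: nneseries_ge0 => u _ _; rewrite lee_fin.
apply: (@le_trans _ _ (\int[unif]_t ((- ln delta)%:E + (ln 2)%:E * \sum_(0 <= u <oo) (\1_(hit As u) t)%:E))%E).
  apply: ge0_le_integral => //.
  - by move=> t _; exact: neglog_ge0.
  - apply: (measurableT_comp measurable_neglog).
    exact: (measurableT_comp (measurable_dA sA) (measurableT_comp (measurable_line v) mf)).
  - by apply: emeasurable_funD => //; apply: emeasurable_funM.
rewrite ge0_integralD//; last 2 first.
- by move=> t _; rewrite mule_ge0// lee_fin ltW.
- exact: emeasurable_funM.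
rewrite integral_cst_prob ge0_integralZl//; last by rewrite lee_fin ltW.
rewrite integral_nneseries//; last first.
  by move=> u; apply/measurable_EFinP; apply: measurable_indic; exact: measurable_hit.
rewrite (eq_eseriesr (g := fun u => unif (hit As u))); last first.
  by move=> u _; rewrite integral_indic ?setIT//; exact: measurable_hit.
rewrite addeC EFinD leeD2r// EFinM lee_pmul2l ?lte_fin//.
exact: hit_series_le.
Qed.

(** The slice bound is uniform in [v], so it survives integration over [x] by Fubini. *)
Lemma perturb_entropy (e : R) : 0 < e -> \forall n \near \oo, exists2 B, B <= (1 + e) * ln n%:R &
  forall A, codebooks n A -> (\int[nu]_y neglog (dA y A) <= B%:E)%E.
Proof.
move=> e0; apply: filterS (entropy_asymptotics (- ln delta) e0) => n [U [J [nU UJ hB]]].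
eexists; first exact: hB.
move=> A cA; have sA : (0 < size A)%N by case/andP: cA.
have mn : measurable_fun setT (fun y : Rm R m.+1 => neglog (dA y A)).
  exact: (measurableT_comp measurable_neglog (measurable_dA sA)).
have mnp := measurableT_comp mn (@measurable_perturb _ _ k delta).
rewrite (ge0_integral_law (@measurable_perturb _ _ k delta) nuP)//; last by move=> y; exact: neglog_ge0.
rewrite fubini_tonelli1//; last by move=> w; exact: neglog_ge0.
rewrite -[leRHS](integral_cst_prob mu); apply: ge0_le_integral => //.
- by move=> x _; apply: integral_ge0 => t _; exact: neglog_ge0.
- by apply: measurable_fun_fubini_tonelli_F => // w; exact: neglog_ge0.
- move=> x _; have h := perturb_slice_le (cut_mx k x) cA nU UJ.
  by apply: le_trans h; rewrite /fubini_F.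
Qed.

Lemma perturb_codebook : \forall n \near \oo, exists2 A, codebooks n A &
  forall w : @space R m, dA (perturb k delta w) A <= 2 * (size rng)%:R / n%:R.
Proof.
exists (size rng) => // n /= Kn.
pose g := (n %/ size rng)%N.
have g0 : (0 < g)%N by rewrite divn_gt0.
have gR : 0 < g%:R :> R by rewrite ltr0n.
have n0 : 0 < n%:R :> R by rewrite ltr0n (leq_trans rng_gt0).
(* For each rounded value, these are the images of the midpoints of [g] equal subintervals of [-1,
   1), the range of [fcantor]. *)
pose A := [seq line v (delta * (((2 * i).+1)%:R / g%:R - 1)) | v <- rng, i <- iota 0 g].
have sA : size A = (size rng * g)%N by rewrite size_allpairs size_iota.
exists A.
  by apply/andP; rewrite sA muln_gt0 rng_gt0 g0 mulnC; split=> //; exact: leq_trunc_div.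
move=> w; have [f1 f2] := andP (fcantor_bounds w.2).
pose z := g%:R * ((fcantor w.2 + 1) / 2).
have z0 : 0 <= z by rewrite mulr_ge0// divr_ge0//; lra.
have zg : z < g%:R by rewrite -[ltRHS]mulr1 ltr_pM2l//; lra.
have [i1 i2] := andP (truncn_itv z0); set i := Num.truncn z in i1 i2.
have ig : (i < g)%N by rewrite -(ltr_nat R); exact: le_lt_trans zg.
have aA : line (cut_mx k w.1) (delta * (((2 * i).+1)%:R / g%:R - 1)) \in A.
  by apply: allpairs_f; [exact: cut_mx_range|rewrite mem_iota].
apply: le_trans (dA_le _ aA) _; apply: le_trans (edist_line _ _ _) _.
rewrite -mulrBr normrM (gtr0_norm d0).
apply: (@le_trans _ _ g%:R^-1).
  apply: (@le_trans _ _ (1 * g%:R^-1)); last by rewrite mul1r.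
  apply: ler_pM => //; first exact: ltW.
  have -> : fcantor w.2 - (((2 * i).+1)%:R / g%:R - 1) = (2 * z - (2 * i).+1%:R) / g%:R.
    by rewrite /z; field; rewrite gt_eqF.
  rewrite normrM normfV (gtr0_norm gR) ler_pdivrMr// mulVf ?gt_eqF//.
  have e1 : (2 * i).+1%:R = 2 * i%:R + 1 :> R by rewrite -addn1 natrD natrM.
  have e2 : i.+1%:R = i%:R + 1 :> R by rewrite -addn1 natrD.
  by rewrite e1 ler_norml; move: i2; rewrite e2 => i2; apply/andP; split; lra.
rewrite -div1r ler_pdivlMr// mulrAC ler_pdivrMr// mul1r -natrM -natrM ler_nat.
have := divn_eq n (size rng); have := ltn_pmod n rng_gt0; rewrite -/g => h1 h2.
rewrite {1}h2 mulnAC -mulnA mul2n -addnn mulnC leq_add2l.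
by apply: leq_trans (ltnW h1) _; rewrite -{1}[size rng]muln1 leq_mul2l g0 orbT.
Qed.

(** Balls around the grid points of [dip_near_grid], for all indices [j] of generation [p] and all
    rounded values. *)
Definition cover_seq p : seq ('rV[R]_m.+1 * R) :=
  [seq (line vg.1 (delta * (vg.2%:R * dy (win j) - 1)), dy (4 * win j))
  | j <- iota (2 ^ p).-1 (2 ^ p), vg <- [seq (v, g) | v <- rng, g <- iota 0 (2 ^ (win j).+1).+1]].

Lemma cover_seqP p (w : @space R m) : exists2 c, c \in cover_seq p & edist (perturb k delta w) c.1 <= c.2.
Proof.
suff [j [g [jp gj h]]] : exists j g, [/\ (2 ^ p <= j.+1 < 2 ^ p.+1)%N, (g <= 2 ^ (win j).+1)%N &
    `|fcantor w.2 - (g%:R * dy (win j) - 1)| <= dy (4 * win j)].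
  exists (line (cut_mx k w.1) (delta * (g%:R * dy (win j) - 1)), dy (4 * win j)).
    apply/allpairsPdep; exists j, (cut_mx k w.1, g); split=> //.
      by rewrite mem_iota; move: jp; rewrite expnS; lia.
    by apply: allpairs_f; [exact: cut_mx_range|rewrite mem_iota].
  apply: le_trans (edist_line _ _ _) _ => /=.
  rewrite -mulrBr normrM (gtr0_norm d0) -[leRHS]mul1r; apply: ler_pM => //; exact: ltW.
have [tI|tI] := boolP (unit_dom w.2).
  have [j jp dj] := dip_ex p tI; have [g gj h] := dip_near_grid tI dj.
  by exists j, g.
(* Outside [0, 1) the value 0 of [fcantor] is itself a grid point, for any index of the
   generation. *)
exists (2 ^ p).-1, (2 ^ win (2 ^ p).-1)%N; split.
- have p0 : (0 < 2 ^ p)%N by rewrite expn_gt0.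
  by rewrite expnS; move: (2 ^ p)%N p0; lia.
- by rewrite leq_exp2l.
- by rewrite /fcantor (negbTE tI) natrX exp2_dy subrr subr0 normr0 ltW// dy_gt0.
Qed.

Lemma cover_seq_radius p c : c \in cover_seq p -> 0 <= c.2 <= dy p.
Proof.
move=> /allpairsPdep[j [vg [jp _ ->]]] /=; rewrite ltW ?dy_gt0//=; apply: le_dy.
move: jp; rewrite mem_iota => /andP[jp _]; have := win_ge_double j; have := ltn_expl p (isT : 1 < 2)%N.
by move: jp; move: (2 ^ p)%N; lia.
Qed.

(** For each [j], at most [4 * 2 ^ win j] grid points per rounded value each contribute at most
    [2 * dy (2 * win j)]. *)
Lemma cover_seq_sum p : \sum_(c <- cover_seq p) (2 * c.2) `^ 2^-1 <= 8 * (size rng)%:R * dy p.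
Proof.
rewrite big_allpairs_dep /=.
have term j : \sum_(vg <- [seq (v, g) | v <- rng, g <- iota 0 (2 ^ (win j).+1).+1])
    (2 * dy (4 * win j)) `^ 2^-1 <= 8 * (size rng)%:R * dy (win j) :> R.
  rewrite big_const_seq count_predT size_allpairs size_iota iter_addr_0.
  have sq : (2 * dy (4 * win j)) `^ 2^-1 <= 2 * dy (2 * win j) :> R.
    rewrite powR12_sqrt ?mulr_ge0 ?(ltW (dy_gt0 _))//.
    rewrite -(@ler_pXn2r _ 2)// ?nnegrE ?sqrtr_ge0 ?mulr_ge0 ?(ltW (dy_gt0 _))//.
    rewrite sqr_sqrtr ?mulr_ge0 ?(ltW (dy_gt0 _))// exprMn.
    rewrite (_ : dy (2 * win j) ^+ 2 = dy (4 * win j)); last first.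
      by rewrite /dy -exprM; congr (_ ^+ _); lia.
    by rewrite ler_pM2r ?dy_gt0// -natrX ler_nat.
  rewrite -[leLHS]mulr_natl; apply: le_trans (ler_wpM2l (ler0n _ _) sq) _.
  apply: (@le_trans _ _ ((size rng * (4 * 2 ^ win j))%N%:R * (2 * dy (2 * win j)))).
    apply: ler_wpM2r; first by rewrite mulr_ge0// ltW// dy_gt0.
    rewrite ler_nat leq_mul2l expnS; apply/orP; right.
    have w0 : (0 < 2 ^ win j)%N by rewrite expn_gt0.
    by move: (2 ^ win j)%N w0; lia.
  rewrite mul2n -addnn dyD !natrM natrX.
  rewrite le_eqVlt; apply/orP; left; apply/eqP.
  transitivity (8 * (size rng)%:R * (2 ^+ win j * dy (win j)) * dy (win j) : R); first by ring.
  by rewrite exp2_dy mulr1.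
(* As [win j >= 2 p], one factor [dy p] pays for the [2 ^ p] indices and the other tends to 0. *)
apply: (@le_trans _ _ (\sum_(j <- iota (2 ^ p).-1 (2 ^ p)) 8 * (size rng)%:R * (dy p * dy p))).
  rewrite big_seq [leRHS]big_seq; apply: ler_sum => j jp; apply: le_trans (term j) _.
  apply: ler_wpM2l; first by rewrite mulr_ge0.
  rewrite -dyD; apply: le_dy; move: jp; rewrite mem_iota => /andP[jp _].
  have := win_ge_double j; have := ltn_expl p (isT : 1 < 2)%N.
  by move: jp; move: (2 ^ p)%N; lia.
rewrite big_const_seq count_predT size_iota iter_addr_0 -[leLHS]mulr_natl natrX.
rewrite [leLHS](_ : _ = 8 * (size rng)%:R * (2 ^+ p * dy p) * dy p); last by ring.
by rewrite exp2_dy mulr1.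
Qed.

(** The intersection [E] of the covers of all generations is a Borel set of full measure. *)
Lemma perturb_dimH : (dimH nu <= (2^-1)%:E)%E.
Proof.
pose E : set (Rm R m.+1) := \bigcap_p \bigcup_(c in [set` cover_seq p]) [set y | edist y c.1 <= c.2].
have mE : measurable E.
  apply: bigcapT_measurable => p.
  by rewrite bigcup_seq; apply: bigsetU_measurable => c _; exact: measurable_cball.
apply: (@dimH_le _ _ _ E) => //; last first.
- apply: Hmeas_eq0 => [|e e0]; first by rewrite invr_ge0.
  have [p hp] : exists p : nat, (8 * (size rng)%:R + 1) / e <= p%:R.
    by exists (Num.truncn ((8 * (size rng)%:R + 1) / e)).+1; apply: ltW; rewrite truncnS_gt.
  have pe : (8 * (size rng)%:R + 1) * dy p <= e.
    rewrite dyE ler_pdivrMr ?exprn_gt0// [e * _]mulrC -ler_pdivrMr//.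
    by apply: le_trans hp _; rewrite -natrX ler_nat ltnW// ltn_expl.
  have h0 : 0 <= 8 * (size rng)%:R * dy p :> R by rewrite !mulr_ge0// ltW// dy_gt0.
  have h1 := dy_gt0 (R := R) p.
  exists (cover_seq p); split.
  + by move=> c /cover_seq_radius/andP[c0 cp]; rewrite c0 /=; lra.
  + by move=> x /(_ p Logic.I)[c /= cp xc]; exists c.
  + by apply: le_trans (cover_seq_sum p) _; lra.
- rewrite nuP// (_ : perturb k delta @^-1` E = setT) ?probability_setT//.
  apply/seteqP; split => w // _ p _; have [c cp h] := cover_seqP p w.
  by exists c.
Qed.

Lemma perturb_Omega0gt : Omega0gt nu.
Proof.
have C0 : 0 < 2 * (size rng)%:R :> R by rewrite mulr_gt0// ltr0n.
have [DR D0] := quantization_dimension1 (@measurable_perturb _ _ k delta) nuP C0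
  perturb_entropy perturb_codebook.
split; first by apply: (perturb_in_Omega nuP); rewrite (ltW d0).
exists 1; split; last split => //.
- exists 1; split=> //; exists (fun=> 1); split; last exact: cvg_cst.
  by move=> r /andP[r0 _]; exact: DR.
- apply: le_lt_trans perturb_dimH _; rewrite lte_fin; lra.
Qed.

End CantorPerturbation.

(** * Density of both sets *)

Unset Implicit Arguments.

Theorem theorem3p11 (R : realType) (m : nat) (hm : (0 < m)%N) :
  (forall (mu : probability (Rm R m) R), in_Omega mu ->
     forall eps : R, 0 < eps ->
     exists nu : probability (Rm R m) R, Omega0 nu /\ (dL mu nu < eps%:E)%E) /\
  (forall (mu : probability (Rm R m) R), in_Omega mu ->
     forall eps : R, 0 < eps ->
     exists nu : probability (Rm R m) R, Omega0gt nu /\ (dL mu nu < eps%:E)%E).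
Proof.
case: m hm => // m _; split=> mu imu eps eps0.
- have [k hk] := cut_approx imu eps0.
  (* With [delta = 0] only the rounding remains, so the law is finitely supported. *)
  have [nu nuP] := has_law_exists (coupling mu) (@measurable_perturb _ _ k 0).
  have d01 : 0 <= (0 : R) <= 1 by rewrite lexx ler01.
  exists nu; split; last by have := perturb_dL nuP d01 imu hk; rewrite addr0.
  apply: (finite_support_Omega0 (A0 := cut_range k) (@measurable_perturb _ _ k 0) nuP).
  + by rewrite -has_predT; apply/hasP; exists (cut_mx k 0) => //; exact: cut_mx_range.
  + by move=> w; rewrite /perturb mul0r line0; exact: cut_mx_range.
  + exact: perturb_in_Omega nuP d01.
- have eps2 : 0 < eps / 2 by rewrite divr_gt0.
  have [k hk] := cut_approx imu eps2.
  (* Half of [eps] goes to the rounding and half to the shift. *)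
  pose delta := Num.min 1 (eps / 2).
  have d0 : 0 < delta by rewrite lt_min ltr01.
  have d1 : delta <= 1 by rewrite ge_min lexx.
  have d2 : delta <= eps / 2 by rewrite ge_min lexx orbT.
  have [nu nuP] := has_law_exists (coupling mu) (@measurable_perturb _ _ k delta).
  exists nu; split; first by apply: perturb_Omega0gt nuP _; rewrite d0.
  apply: lt_le_trans (perturb_dL nuP _ imu hk) _; first by rewrite (ltW d0).
  by rewrite lee_fin; lra.
Qed.
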